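(* Let $\{\tilde f_j(m),\tilde g_j(m)\}=\{\Gamma_1(f_j(m)),\Gamma_2(g_j(m))\}$, elements of $\mathcal H(K_1)$ and $\mathcal H(K_2)$ respectively, denote the regularized weight functions corresponding to the truncated-singular-value-decomposition version of canonical correlation analysis. Then, as $m\to\infty$, for $j=1,2,\ldots$, $$\|\tilde f_j(m)-\tilde f_j\|_{\mathcal H(K_1)}\to0\quad\text{and}\quad\|\tilde g_j(m)-\tilde g_j\|_{\mathcal H(K_2)}\to0 .$$
   Context: Setting. $E\subseteq\mathbb R$, $\nu$ is a $\sigma$-finite measure on $E$, $\mathcal H=L^2(E,\nu)$, $X$ is a mean-zero random element of $\mathcal H$ with $\mathrm E\|X\|^4_{\mathcal H}<\infty$ and covariance operator $S=\mathrm E[X\otimes X]$, where $(f\otimes g)h=\langle f,h\rangle g$. $\mathcal H=\mathcal H_1\oplus\mathcal H_2$ with $\mathcal H_1\perp\mathcal H_2$ closed subspaces and orthogonal projections $\Upsilon_1,\Upsilon_2$; $X_i=\Upsilon_iX$, $S_i=\Upsilon_iS\Upsilon_i$ (on $\mathcal H_i$, injective), $S_{12}=\Upsilon_1S\Upsilon_2:\mathcal H_2\to\mathcal H_1$. $\{\phi_{ij}\}_j$ is an orthonormal basis of $\mathcal H_i$ of eigenvectors of $S_i$ with eigenvalues $\lambda_{i1}\ge\lambda_{i2}\ge\cdots>0$, and $P_{ih}$ is the eigenprojection of $S_i$ for its $h$-th largest distinct eigenvalue. Let $\gamma_{jk}=\mathrm E[\langle X_1,\phi_{1j}\rangle\langle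 X_2,\phi_{2k}\rangle]$. $A^\dagger$ is the Moore–Penrose inverse. RKHS. $\mathcal H(K_i)$ is the reproducing kernel Hilbert space of the covariance kernel $K_i$ of $X_i$: as a set it is $\operatorname{Im}(S_i^{1/2})$, with $\|f\|^2_{\mathcal H(K_i)}=\sum_j\langle f,\phi_{ij}\rangle^2/\lambda_{ij}$. $\Gamma_i:\mathcal H_i\to\mathcal H(K_i)$, $\Gamma_ig=\sum_j\sqrt{\lambda_{ij}}\langle g,\phi_{ij}\rangle\phi_{ij}$, is unitary. Operators. $T:\mathcal H(K_2)\to\mathcal H(K_1)$ is $(T\tilde g)(s)=\langle K_{12}(s,\cdot),\tilde g\rangle_{\mathcal H(K_2)}$ with $K_{12}(s,t)=\mathrm E[X_1(s)X_2(t)]$; equivalently $T=\Gamma_1C\Gamma_2^{-1}$, where $C:\mathcal H_2\to\mathcal H_1$ is the bounded operator with $\langle C\phi_{2k},\phi_{1j}\rangle=\gamma_{jk}/\sqrt{\lambda_{1j}\lambda_{2k}}$. $T$ is assumed to admit a singular value decomposition $T=\sum_k\rho_k\,\tilde g_k\otimes_{\mathcal H(K_2)}\tilde f_k$ with $\rho_1\ge\rho_2\ge\cdots\ge0$ and orthonormal systems $\{\tilde f_k\}\subset\mathcal H(K_1)$ (eigenvectors of $TT^*$), $\{\tilde g_k\}\subset\mathcal H(K_2)$ (eigenvectors of $T^*T$). Truncation. For $m\ge1$, $\Pi_i(m)=\sum_{h=1}^mP_{ih}$, $S_i(m)=S_i\Pi_i(m)$, $R(m)=(S_1(m)^{1/2})^{\dagger}S_{12}(S_2(m)^{1/2})^{\dagger}:\mathcal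 H_2\to\mathcal H_1$, with singular value decomposition $R(m)=\sum_{j=1}^{\operatorname{rank}(R(m)^*R(m))}\rho_j(m)\,g_j(m)\otimes_{\mathcal H_2}f_j(m)$, singular values in decreasing order. Sign convention. Eigenvectors being determined only up to sign, without loss of generality they are taken so that $\langle\tilde f_j(m),\tilde f_j\rangle_{\mathcal H(K_1)}\ge0$ and $\langle\tilde g_j(m),\tilde g_j\rangle_{\mathcal H(K_2)}\ge0$. *)

(* Defs.v *)
From HB Require Import structures.
From mathcomp Require Import all_boot all_order all_algebra.
From mathcomp Require Import all_classical all_reals all_analysis.
From mathcomp Require Import measurable_realfun lebesgue_measure.
Set Implicit Arguments.
Unset Strict Implicit.
Unset Printing Implicit Defensive.
Import Order.TTheory GRing.Theory Num.Theory.
Import numFieldNormedType.Exports.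
Local Open Scope classical_set_scope.
Local Open Scope card_scope.
Local Open Scope ring_scope.
Section L2_space.
Context d (T : measurableType d) (R : realType) (mu : {measure set T -> \bar R}).
(* The library's L^2 space (classes of measurable functions modulo equality
   mu-almost everywhere) comes without algebraic or topological structure: here
   it is made a normed module, the operations being induced by the pointwise
   ones and the norm being the library's L^2 norm. *)
Definition L2 : Type := LspaceType mu (lee1n 2).
Definition L2_fun (x : L2) : T -> R := x.
Coercion L2_fun : L2 >-> Funclass.
Local Notation F := (LfunType mu (lee1n 2)).
Local Notation N2 f := ('N[mu]_(2%:R%:E)[EFin \o f])%E.
Implicit Types (f g h : F) (x y z : L2) (a b : R).

Lemma eq_ae_Lnorm2 (f g : T -> R) :
  measurable_fun [set: T] f -> measurable_fun [set: T] g ->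
  f = g %[ae mu] -> N2 f = N2 g.
Proof.
move=> mf mg fg; rewrite unlock; congr poweR.
have mpow (h : T -> R) : measurable_fun [set: T] h ->
    measurable_fun [set: T] (fun t => `|h t| `^ 2).
  move=> mh.
  apply: (@measurableT_comp _ _ _ _ _ _ (@powR R ^~ 2)) => //.
  exact: measurableT_comp.
apply: ae_eq_integral => //=; [exact/measurable_EFinP/mpow|exact/measurable_EFinP/mpow|].
by move: fg; apply: filterS => t /(_ I) /= ->.
Qed.

Section of_Lfun.
Variable f : F.
Let g : T -> measurableTypeR R := f.
Let mg : measurable_fun [set: T] g.
Proof. exact: (@measurable_funPT _ _ _ _ f). Qed.
HB.instance Definition _ := isMeasurableFun.Build _ _ _ _ g mg.
Let c : {mfun_ mu, T >-> measurableTypeR R} :=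
  (\pi_(aeEqMfun (measurableTypeR R) mu) (g : {mfun T >-> measurableTypeR R}))%qT.

Let c_ae : (c : T -> R) = f %[ae mu].
Proof.
suff /asboolP : ae_eq_op mu (repr c) (g : {mfun T >-> measurableTypeR R}) by [].
by have /eqquotP := reprK c.
Qed.

Let c_fin : finite_norm mu 2%:R%:E c.
Proof.
rewrite /finite_norm (@eq_ae_Lnorm2 c f) //.
- exact: Lfunction_finite.
- exact: (@measurable_funPT _ _ _ _ (repr c)).
Qed.

HB.instance Definition _ := isFinLebesgue.Build _ _ _ _ _ (lee1n 2) c c_fin.

Definition L2_of_Lfun : L2 := c : LspaceType mu (lee1n 2).

Lemma L2_of_LfunE : L2_of_Lfun = f %[ae mu].
Proof. exact: c_ae. Qed.

End of_Lfun.

Lemma L2_mfun x : measurable_fun [set: T] x.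
Proof. exact: (@measurable_funPT _ _ _ _ (repr (LebesgueSpace.sort x))). Qed.

Lemma L2_fin x : finite_norm mu 2%:R%:E x.
Proof. exact: Lebesgue_finite. Qed.

Lemma L2P x y : x = y %[ae mu] -> x = y.
Proof.
move=> xy; have : LebesgueSpace.sort x = LebesgueSpace.sort y.
  rewrite -[LHS]reprK -[RHS]reprK; apply/eqquotP; exact/asboolP.
case: x y {xy} => [x [[px]]] [y [[py]]] /= xy; subst y.
by rewrite (bool_irrelevance px py).
Qed.

Section to_Lfun.
Variable x : L2.
Let g : T -> R := x.
Let mg : measurable_fun [set: T] g := L2_mfun x.
HB.instance Definition _ := isMeasurableFun.Build _ _ _ _ g mg.
Let fg : finite_norm mu 2%:R%:E g := L2_fin x.
HB.instance Definition _ := isLfunction.Build _ _ _ _ _ (lee1n 2) g fg.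
Definition Lfun_of_L2 : F := g.
End to_Lfun.

Lemma L2_ofK x : L2_of_Lfun (Lfun_of_L2 x) = x.
Proof. exact/L2P/L2_of_LfunE. Qed.

Lemma eq_L2_of f g : f = g %[ae mu] -> L2_of_Lfun f = L2_of_Lfun g.
Proof.
move=> fg; apply: L2P; apply: ae_eq_trans (L2_of_LfunE f) _.
exact: ae_eq_trans fg (ae_eq_sym (L2_of_LfunE g)).
Qed.

Definition L2_zero : L2 := L2_of_Lfun 0.
Definition L2_opp x : L2 := L2_of_Lfun (- Lfun_of_L2 x).
Definition L2_add x y : L2 := L2_of_Lfun (Lfun_of_L2 x + Lfun_of_L2 y).
Definition L2_scale a x : L2 := L2_of_Lfun (a *: Lfun_of_L2 x).
Definition L2_norm x : R := fine (N2 x).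

Lemma L2_addE x y : L2_add x y = (fun t => x t + y t) %[ae mu].
Proof. exact: L2_of_LfunE. Qed.

Lemma L2_addf f g : L2_add (L2_of_Lfun f) (L2_of_Lfun g) = L2_of_Lfun (f + g).
Proof.
apply: eq_L2_of; have := L2_of_LfunE f; have := L2_of_LfunE g.
apply: filterS2 => t /(_ I) /= gE /(_ I) /= fE _.
by transitivity (L2_of_Lfun f t + L2_of_Lfun g t); [|rewrite fE gE].
Qed.

Lemma L2_scalef a f : L2_scale a (L2_of_Lfun f) = L2_of_Lfun (a *: f).
Proof.
apply: eq_L2_of; have := L2_of_LfunE f.
apply: filterS => t /(_ I) /= fE _.
by transitivity (a * L2_of_Lfun f t); [|rewrite fE].
Qed.

Lemma L2_addA : associative L2_add.
Proof.
move=> x y z; rewrite -(L2_ofK x) -(L2_ofK y) -(L2_ofK z) !L2_addf.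
by rewrite addrA.
Qed.

Lemma L2_addC : commutative L2_add.
Proof. by move=> x y; rewrite /L2_add addrC. Qed.

Lemma L2_add0 : left_id L2_zero L2_add.
Proof. by move=> x; rewrite -(L2_ofK x) L2_addf add0r. Qed.

Lemma L2_addN : left_inverse L2_zero L2_opp L2_add.
Proof.
by move=> x; rewrite -{2}(L2_ofK x) L2_addf addNr.
Qed.

HB.instance Definition _ := gen_eqMixin L2.
HB.instance Definition _ := gen_choiceMixin L2.
HB.instance Definition _ :=
  GRing.isZmodule.Build L2 L2_addA L2_addC L2_add0 L2_addN.

Lemma L2_scaleA a b x : L2_scale a (L2_scale b x) = L2_scale (a * b) x.
Proof. by rewrite -(L2_ofK x) !L2_scalef scalerA. Qed.

Lemma L2_scale1 : left_id 1 L2_scale.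
Proof. by move=> x; rewrite -(L2_ofK x) L2_scalef scale1r. Qed.

Lemma L2_scaleDr : right_distributive L2_scale +%R.
Proof.
move=> a x y; rewrite -(L2_ofK x) -(L2_ofK y).
by rewrite [in LHS]/GRing.add/= L2_addf !L2_scalef [in RHS]/GRing.add/= L2_addf scalerDr.
Qed.

Lemma L2_scaleDl x : {morph L2_scale^~ x : a b / a + b}.
Proof.
move=> a b; rewrite -(L2_ofK x) !L2_scalef.
by rewrite [in RHS]/GRing.add/= L2_addf scalerDl.
Qed.

HB.instance Definition _ :=
  GRing.Zmodule_isLmodule.Build R L2 L2_scaleA L2_scale1 L2_scaleDr L2_scaleDl.

Lemma L2_norm_of f : L2_norm (L2_of_Lfun f) = fine (N2 f).
Proof.
by rewrite /L2_norm (@eq_ae_Lnorm2 _ f) //; exact: L2_of_LfunE.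
Qed.

Lemma L2_normD x y : L2_norm (x + y) <= L2_norm x + L2_norm y.
Proof. by rewrite [x + y]/(L2_add x y) L2_norm_of; exact: ler_LnormD. Qed.

Lemma L2_normZ a x : L2_norm (a *: x) = `|a| * L2_norm x.
Proof.
rewrite [a *: x]/(L2_scale a x) L2_norm_of; apply: EFin_inj.
by rewrite EFinM !finite_norm_fine LnormZ.
Qed.

Lemma L2_norm_eq0 x : L2_norm x = 0 -> x = 0.
Proof.
move=> x0; rewrite -(L2_ofK x); apply: eq_L2_of.
exact: (@fine_Lnormr_eq0 _ _ _ mu _ _ (Lfun_of_L2 x)).
Qed.

HB.instance Definition _ :=
  Lmodule_isNormed.Build R L2 L2_normD L2_normZ L2_norm_eq0.

Definition L2_dot x y : R := \int[mu]_t (x t * y t).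

Lemma L2_normE x : `|x| ^+ 2 = L2_dot x x.
Proof.
have nE : (`|x|)%:E = N2 x := finite_norm_fine (Lfun_of_L2 x).
have x2 : (x : T -> R) \in Lfun mu 2%:R%:E := LfunP (Lfun_of_L2 x).
rewrite -powR_mulrn//; apply: EFin_inj.
rewrite -poweR_EFin nE powR_Lnorm ?pnatr_eq0// /L2_dot /Rintegral.
rewrite (_ : (fun t => (x t * x t)%:E) = (fun t => (`|x t| `^ 2)%:E)).
  by rewrite fineK//; apply: integrable_fin_num => //; apply: Lfun_integrable => //; rewrite ler1n.
by apply/funext => t; rewrite powR_mulrn// real_normK ?num_real// expr2.
Qed.

End L2_space.

(* A vector subspace with an inner product of its own: the closed subspaces of
   L^2 and the reproducing kernel Hilbert spaces are both of this form. *)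
Record innerSpace (R : realType) (V : lmodType R) :=
  InnerSpace { carrier : set V ; dot : V -> V -> R }.

(* The initial segment of nat that indexes a finite (Some n) or an infinite
   (None) sequence. Indices start at 0. *)
Definition idx (N : option nat) (k : nat) : bool :=
  if N is Some n then (k < n)%N else true.

Section InnerSpaces.
Context (R : realType) (V : lmodType R).
Implicit Types (U W : innerSpace V) (A B : V -> V) (N : option nat).

Definition nrm W (x : V) : R := Num.sqrt (dot W x x).

Definition tensor W (f g : V) : V -> V := fun h => dot W f h *: g.

Definition partial_sum (M : nmodType) N (u : nat -> M) (n : nat) : M :=
  \sum_(0 <= k < n | idx N k) u k.

Definition has_sum W N (u : nat -> V) (x : V) : Prop :=
  (fun n => nrm W (x - partial_sum N u n)) @ \oo --> (0 : R).

Definition orthonormal_system W N (e : nat -> V) : Prop :=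
  (forall k, idx N k -> carrier W (e k)) /\
  (forall j k, idx N j -> idx N k -> dot W (e j) (e k) = (j == k)%:R).

Definition orthonormal_basis W N (e : nat -> V) : Prop :=
  orthonormal_system W N e /\
  (forall x, carrier W x -> has_sum W N (fun k => tensor W (e k) (e k) x) x).

Definition nonincreasing_on N (a : nat -> R) : Prop :=
  forall j k, (j <= k)%N -> idx N k -> a k <= a j.

Definition bounded_operator U W A : Prop :=
  [/\ forall x, carrier U x -> carrier W (A x),
      forall (a : R) x y, carrier U x -> carrier U y ->
        A (a *: x + y) = a *: A x + A y
    & exists M : R, forall x, carrier U x -> nrm W (A x) <= M * nrm U x].

Definition is_adjoint U W A B : Prop :=
  (forall y, carrier W y -> carrier U (B y)) /\
  (forall x y, carrier U x -> carrier W y -> dot W (A x) y = dot U x (B y)).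

(* A = \sum_k rho_k (g_k \otimes_U f_k), as an operator from U to W *)
Definition singular_value_decomposition U W N A
    (rho : nat -> R) (f g : nat -> V) : Prop :=
  [/\ orthonormal_system W N f,
      orthonormal_system U N g,
      forall k, idx N k -> 0 <= rho k,
      nonincreasing_on N rho
    & forall x, carrier U x ->
        has_sum W N (fun k => rho k *: tensor U (g k) (f k) x) (A x)].

Definition eigenvalue_on W A (mu : R) : Prop :=
  exists x, [/\ carrier W x, x <> 0 & A x = mu *: x].

(* mu is the (h+1)-th largest distinct eigenvalue *)
Definition nth_eigenvalue W A (h : nat) (mu : R) : Prop :=
  eigenvalue_on W A mu /\
  [set mu' | eigenvalue_on W A mu' /\ mu < mu'] #= `I_h.

(* reduced to 0 when there are at most h distinct eigenvalues *)
Definition nth_eigenspace W A (h : nat) : set V :=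
  [set x | x = 0 \/
    exists2 mu, nth_eigenvalue W A h mu & carrier W x /\ A x = mu *: x].

Definition unit_eigenvector_up_to_sign W A (mu : R) (e : V) : Prop :=
  forall x, carrier W x -> nrm W x = 1 -> A x = mu *: x -> x = e \/ x = - e.

End InnerSpaces.

Definition whole_space (R : realType) (V : lmodType R) (ip : V -> V -> R) :=
  InnerSpace [set: V] ip.

Section Operators.
Context (R : realType) (V : normedModType R) (ip : V -> V -> R).
Implicit Types (A B : V -> V) (D : set V) (N : option nat).

Local Notation whole := (whole_space ip).

Definition closed_subspace D : Prop :=
  [/\ closed D, D 0 & forall (a : R) x y, D x -> D y -> D (a *: x + y)].

Definition orthproj D (x : V) : V :=
  xget 0 [set u | D u /\ forall v, D v -> ip (x - u) v = 0].

Definition self_adjoint A : Prop := is_adjoint whole whole A A.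

Definition is_sqrt_op A B : Prop :=
  [/\ bounded_operator whole whole B, self_adjoint B,
      forall x, 0 <= ip (B x) x & B \o B = A].

Definition sqrt_op A : V -> V := xget (fun=> 0) (is_sqrt_op A).

(* The Penrose equations. A bounded solution exists exactly when A has closed
   range, which is the case for the finite rank operators to which this is
   applied. *)
Definition is_mp_inverse A B : Prop :=
  [/\ bounded_operator whole whole B, A \o B \o A = A, B \o A \o B = B,
      self_adjoint (A \o B) & self_adjoint (B \o A)].

Definition mp_inverse A : V -> V := xget (fun=> 0) (is_mp_inverse A).

Definition eigenprojection D A (h : nat) : V -> V :=
  orthproj (nth_eigenspace (InnerSpace D ip) A h).

(* \sum_k sqrt(lambda_k) <g, phi_k> phi_k *)
Definition sqrt_series N (lambda : nat -> R) (phi : nat -> V) (g : V) : V :=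
  limn (partial_sum N (fun k => (Num.sqrt (lambda k) * ip g (phi k)) *: phi k)).

(* The reproducing kernel Hilbert space of the covariance kernel with
   covariance operator A, whose eigenvalues and orthonormal eigenvectors are
   lambda and phi. The inner product is the polarization of the squared norm
   \sum_k <f, phi_k>^2 / lambda_k. *)
Definition rkhs A N (lambda : nat -> R) (phi : nat -> V) : innerSpace V :=
  InnerSpace (range (sqrt_op A))
    (fun f g => limn (partial_sum N
       (fun k => ip f (phi k) * ip g (phi k) / lambda k))).

Definition eigenbasis D A N (lambda : nat -> R) (phi : nat -> V) : Prop :=
  [/\ orthonormal_basis (InnerSpace D ip) N phi,
      forall k, idx N k -> A (phi k) = lambda k *: phi k,
      forall k, idx N k -> 0 < lambda k
    & nonincreasing_on N lambda].

End Operators.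

(* nu lives on E. For E Borel this says that nu vanishes on the complement of
   E; for an arbitrary E the measures carried by E are the images under the
   inclusion of E in R of the measures on the trace of the Borel sets on E. *)
Definition carried_by (R : realType)
    (nu : {measure set (measurableTypeR R) -> \bar R}) (E : set R) : Prop :=
  forall B : set (measurableTypeR R),
    measurable B -> B `&` E = set0 -> nu B = 0%E.

Section RandomElements.
Context d (Omega : measurableType d) (R : realType) (P : probability Omega R).
Context d' (T : measurableType d') (mu : {measure set T -> \bar R}).

Definition random_element (X : Omega -> L2 mu) : Prop :=
  forall U : set (L2 mu), open U -> measurable (X @^-1` U).

(* y = E[Y], the expectation being characterized by <y, h> = E<Y, h> *)
Definition is_expectation (Y : Omega -> L2 mu) (y : L2 mu) : Prop :=
  forall h : L2 mu,
    P.-integrable [set: Omega] (fun w => (L2_dot (Y w) h)%:E) /\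
    \int[P]_w L2_dot (Y w) h = L2_dot y h.

(* S = E[X \otimes X], i.e. S h = E[(X \otimes X) h] for all h *)
Definition is_covariance_operator (X : Omega -> L2 mu) (S : L2 mu -> L2 mu) :=
  forall h : L2 mu,
    is_expectation
      (fun w => tensor (whole_space (@L2_dot _ _ _ mu))
                  (X w) (X w) h) (S h).

End RandomElements.

(* Main.v *)
Require Import Defs.
From HB Require Import structures.
From mathcomp Require Import all_boot all_order all_algebra.
From mathcomp Require Import all_classical all_reals all_analysis.
From mathcomp Require Import measurable_realfun.
From mathcomp Require Import ring lra.
Set Implicit Arguments.
Unset Strict Implicit.
Unset Printing Implicit Defensive.
Import Order.TTheory GRing.Theory Num.Theory.
Import numFieldNormedType.Exports.
Local Open Scope classical_set_scope.
Local Open Scope ring_scope.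

(* The map Gamma_i is isometric from H_i onto its reproducing kernel space, so
   the claim is about the singular vectors of C and of
   R(m) = Pi_1(m) C Pi_2(m).  Since n lambda_n <= E |X|^2, the eigenvalues tend
   to zero and Pi_i(m) -> I strongly; hence R(m) -> C, but only weakly, as C need
   not be compact.  Ky Fan's inequality bounds sum_(i < k) <C x_i, y_i>, for
   orthonormal systems x and y, by sum_(l < k) rho_l minus the gap at k times the
   deficit of the overlap of x, y with the first k singular vectors of C.
   Applied to R(m) with the singular vectors of C, and to C with those of R(m),
   it squeezes the deficit to zero at each k with rho_k < rho_(k-1).  As
   rho_j is simple, this holds for k = j and k = j + 1, and the difference
   isolates the jth pair of vectors up to the sign, which the convention
   fixes. *)

(** * Ky Fan's inequality and singular vectors *)

(** The two uses of Ky Fan's inequality are linked by an exact identity. The singular values of R(m)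
    being positive, its singular vectors lie in the ranges of the truncating projections, so <R(m)
    g_i(m), f_i(m)> = <C g_i(m), f_i(m)>. Hence the sum of the first k singular values of R(m) is
    both the upper bound in one use and the left side of the other. What remains at the lower end,
    sum_(l < k) <R(m) g_l, f_l>, involves fixed vectors only, which is why weak convergence
    suffices. The square roots, pseudo-inverses and eigenprojections that enter R(m) are given only
    by characterizing properties; each is identified with a finite diagonal operator. For the
    eigenprojections this rests on the finite multiplicities that follow from the bound on n
    lambda_n. *)

Lemma sqrt_cvg0 (R : realType) (u : nat -> R) : u n @[n --> \oo] --> (0 : R) ->
  Num.sqrt (u n) @[n --> \oo] --> (0 : R).
Proof.
move=> u0; have := continuous_cvg _ (@sqrt_continuous R 0) u0.
by rewrite sqrtr0; apply.
Qed.

(** The abstract argument sees the L^2 inner product through these three identities;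
    [L2_dot_inner_product] supplies them. *)
Record inner_product (R : realType) (V : normedModType R) (ip : V -> V -> R) : Prop :=
  InnerProduct {
    ipC : forall x y, ip x y = ip y x ;
    ipP : forall a x y z, ip (a *: x + y) z = a * ip x z + ip y z ;
    ip_norm : forall x, ip x x = `|x| ^+ 2 }.

Section InnerProduct.
Context (R : realType) (V : normedModType R) (ip : V -> V -> R).
Context (ipV : inner_product ip).
Implicit Types (x y z : V) (a : V -> V -> R) (P Q : pred nat) (e f g u v : nat -> V).

Let ipC := ipC ipV.

Lemma ipDl x y z : ip (x + y) z = ip x z + ip y z.
Proof. by have := ipP ipV 1 x y z; rewrite scale1r mul1r. Qed.

Lemma ip0l z : ip 0 z = 0.
Proof. by have := ipDl 0 0 z; rewrite addr0; lra. Qed.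

Lemma ipZl (c : R) x z : ip (c *: x) z = c * ip x z.
Proof. by have := ipP ipV c x 0 z; rewrite addr0 ip0l addr0. Qed.

Lemma ipDr x y z : ip z (x + y) = ip z x + ip z y.
Proof. by rewrite ipC ipDl !(ipC z). Qed.

Lemma ip0r z : ip z 0 = 0. Proof. by rewrite ipC ip0l. Qed.

Lemma ipZr (c : R) x z : ip z (c *: x) = c * ip z x.
Proof. by rewrite ipC ipZl (ipC z). Qed.

Lemma ipNl x z : ip (- x) z = - ip x z.
Proof. by rewrite -scaleN1r ipZl mulN1r. Qed.

Lemma ipNr x z : ip z (- x) = - ip z x.
Proof. by rewrite ipC ipNl ipC. Qed.

Lemma ipBl x y z : ip (x - y) z = ip x z - ip y z.
Proof. by rewrite ipDl ipNl. Qed.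

Lemma ipBr x y z : ip z (x - y) = ip z x - ip z y.
Proof. by rewrite ipDr ipNr. Qed.

Lemma ip_suml I (s : seq I) (p : pred I) (u : I -> V) z :
  ip (\sum_(i <- s | p i) u i) z = \sum_(i <- s | p i) ip (u i) z.
Proof. by apply: (big_morph (ip^~ z)) => [x y|]; [exact: ipDl|exact: ip0l]. Qed.

Lemma ip_sumr I (s : seq I) (p : pred I) (u : I -> V) z :
  ip z (\sum_(i <- s | p i) u i) = \sum_(i <- s | p i) ip z (u i).
Proof. by apply: (big_morph (ip z)) => [x y|]; [exact: ipDr|exact: ip0r]. Qed.

Lemma ip_ge0 x : 0 <= ip x x.
Proof. by rewrite (ip_norm ipV) sqr_ge0. Qed.

Lemma ip_eq0 x : ip x x = 0 -> x = 0.
Proof. by rewrite (ip_norm ipV) => /eqP; rewrite sqrf_eq0 normr_eq0 => /eqP. Qed.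

Lemma ipext x y : (forall z, ip x z = ip y z) -> x = y.
Proof.
move=> xy; apply/eqP; rewrite -subr_eq0; apply/eqP/ip_eq0.
by rewrite ipBl xy subrr.
Qed.

Lemma norm_ip x : `|x| = Num.sqrt (ip x x).
Proof. by rewrite (ip_norm ipV) sqrtr_sqr normr_id. Qed.

Lemma ip_CS x y : `|ip x y| <= `|x| * `|y|.
Proof.
rewrite -(ler_pXn2r (n := 2)) ?nnegrE ?mulr_ge0//.
rewrite real_normK ?num_real// exprMn -!(ip_norm ipV).
have [->|y0] := eqVneq y 0; first by rewrite !ip0r mulr0 expr0n.
have yy : 0 < ip y y.
  rewrite lt_neqAle ip_ge0 andbT eq_sym.
  by apply: contra_neq y0 => /ip_eq0.
have := ip_ge0 (ip y y *: x - ip x y *: y).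
rewrite ipBl !ipBr !ipZl !ipZr (ipC y x) => h.
have : 0 <= ip y y * (ip x x * ip y y - ip x y ^+ 2) by move: h; nra.
by rewrite pmulr_rge0// subr_ge0.
Qed.

Lemma ip_cvg u v x y :
  `|x - u n| @[n --> \oo] --> (0 : R) -> `|y - v n| @[n --> \oo] --> (0 : R) ->
  ip (u n) (v n) @[n --> \oo] --> ip x y.
Proof.
move=> ux vy; pose b n := `|x - u n| * (`|y| + `|y - v n|) + `|x| * `|y - v n|.
have b0 : b n @[n --> \oo] --> (0 : R).
  have -> : (0 : R) = 0 * (`|y| + 0) + `|x| * 0 by rewrite mul0r mulr0 addr0.
  apply: cvgD; last by apply: cvgM => //; exact: cvg_cst.
  by apply: cvgM => //; apply: cvgD => //; exact: cvg_cst.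
apply/cvgrPdist_le => eps eps0; move/cvgrPdist_le : b0 => /(_ _ eps0).
apply: filterS => n; rewrite sub0r normrN => /(le_trans (ler_norm _)).
apply: le_trans.
have -> : ip x y - ip (u n) (v n) = ip (x - u n) (v n) + ip x (y - v n).
  by rewrite ipBl ipBr; ring.
apply: (le_trans (ler_normD _ _)); apply: lerD; last exact: ip_CS.
apply: (le_trans (ip_CS _ _)); apply: ler_wpM2l => //.
by rewrite -{1}(subKr y (v n)) (le_trans (ler_normB _ _)).
Qed.

(* An orthonormal system indexed by [P] and extended by zero. *)
Definition porth P e := forall i j, ip (e i) (e j) = ((i == j) && P i)%:R.

Lemma porth0 P e i : porth P e -> ~~ P i -> e i = 0.
Proof. by move=> eP /negbTE Pi; apply: ip_eq0; rewrite eP eqxx Pi. Qed.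

Lemma porth_le1 P e i : porth P e -> ip (e i) (e i) <= 1.
Proof. by move=> ->; rewrite eqxx/=; case: (P i). Qed.

(** Truncations, their square roots and their pseudo-inverses all take this form, with different
    coefficients [c]. *)
Definition diag e (c : nat -> R) n x := \sum_(i < n) (c i * ip (e i) x) *: e i.

Lemma ip_diag e c n x y :
  ip (diag e c n x) y = \sum_(i < n) c i * ip (e i) x * ip (e i) y.
Proof. by rewrite ip_suml; apply: eq_bigr => i _; rewrite ipZl. Qed.

Lemma diag_sym e c n x y : ip (diag e c n x) y = ip x (diag e c n y).
Proof.
by rewrite [RHS]ipC !ip_diag; apply: eq_bigr => i _; rewrite mulrAC.
Qed.

Lemma diag_basis P e c n (k : nat) : porth P e -> (k < n)%N ->
  diag e c n (e k) = c k *: e k.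
Proof.
move=> eP kn; rewrite /diag (bigD1 (Ordinal kn))//= big1 => [|i ik].
  rewrite eP eqxx/= addr0; case: (boolP (P k)) => Pk; first by rewrite mulr1.
  by rewrite (porth0 eP Pk) !scaler0.
rewrite eP (_ : _ == k = false) ?mulr0 ?scale0r//.
by apply: contraNF ik => /eqP ik; apply/eqP/val_inj.
Qed.

Lemma eq_diag P e c c' n : porth P e ->
  (forall k, (k < n)%N -> P k -> c k = c' k) -> diag e c n = diag e c' n.
Proof.
move=> eP cc; apply/funext => x; apply: eq_bigr => i _.
case: (boolP (P i)) => Pi; first by rewrite cc.
by rewrite (porth0 eP Pi) !scaler0.
Qed.

(** Reduces operator identities for projections, square roots and pseudo-inverses to pointwise
    identities between scalars. *)
Lemma diag_comp P e c c' n : porth P e ->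
  diag e c n \o diag e c' n = diag e (fun k => c k * c' k) n.
Proof.
move=> eP; apply/funext => x; apply: eq_bigr => i _.
by rewrite /= (ipC (e i)) diag_sym (diag_basis _ eP)// ipZr mulrA (ipC x).
Qed.

Lemma bessel P e n x : porth P e -> \sum_(i < n) ip (e i) x ^+ 2 <= ip x x.
Proof.
move=> eP; set s := diag e (fun=> 1) n x.
have sx : ip s x = \sum_(i < n) ip (e i) x ^+ 2.
  by rewrite ip_diag; apply: eq_bigr => i _; rewrite mul1r.
have ss : ip s s = ip s x.
  rewrite /s -diag_sym -[X in ip X x]/((diag e (fun=> 1) n \o _) x).
  by rewrite (diag_comp _ _ _ eP) (@eq_diag P _ _ (fun=> 1)) // => k _ _; rewrite mulr1.
have := ip_ge0 (x - s); rewrite ipBl !ipBr ss (ipC x s) sx; lra.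
Qed.

(* Only the matrix elements are required to converge; everything vanishes
   outside [P]. *)
Record form_svd (D2 D1 : set V) (a : V -> V -> R) P (rho : nat -> R) f g : Prop :=
  FormSvd {
    svd_f : porth P f ; svd_g : porth P g ;
    svd_ge0 : forall k, 0 <= rho k ;
    svd_mono : forall j k, (j <= k)%N -> rho k <= rho j ;
    svd_out : forall k, ~~ P k -> rho k = 0 ;
    svd_D1 : forall k, D1 (f k) ; svd_D2 : forall k, D2 (g k) ;
    svd_cvg : forall x y, D2 x -> D1 y ->
      (\sum_(k < n) rho k * ip (g k) x * ip (f k) y) @[n --> \oo] --> a x y }.

Lemma svdEl D2 D1 a P rho f g i y : form_svd D2 D1 a P rho f g -> D1 y ->
  a (g i) y = rho i * ip (f i) y.
Proof.
move=> A Dy; apply: (cvg_unique _ (svd_cvg A (svd_D2 A i) Dy)) => //.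
apply: cvg_near_cst; near=> n.
have ni : (i < n)%N by near: n; exact: nbhs_infty_gt.
rewrite (bigD1 (Ordinal ni))//= big1 => [|k ki].
  rewrite (svd_g A) eqxx addr0/=.
  case: (boolP (P i)) => Pi; first by rewrite !mulr1.
  by rewrite (svd_out A)// !mul0r.
rewrite (svd_g A) (_ : _ == i = false) ?mulr0 ?mul0r//.
by apply: contraNF ki => /eqP ki; apply/eqP/val_inj.
Unshelve. all: by end_near. Qed.

Lemma svdEr D2 D1 a P rho f g i x : form_svd D2 D1 a P rho f g -> D2 x ->
  a x (f i) = rho i * ip (g i) x.
Proof.
move=> A Dx; apply: (cvg_unique _ (svd_cvg A Dx (svd_D1 A i))) => //.
apply: cvg_near_cst; near=> n.
have ni : (i < n)%N by near: n; exact: nbhs_infty_gt.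
rewrite (bigD1 (Ordinal ni))//= big1 => [|k ki].
  rewrite (svd_f A) eqxx addr0/=.
  case: (boolP (P i)) => Pi; first by rewrite !mulr1.
  by rewrite (svd_out A)// !mul0r.
rewrite (svd_f A) (_ : _ == i = false) ?mulr0 ?mul0r//.
by apply: contraNF ki => /eqP ki; apply/eqP/val_inj.
Unshelve. all: by end_near. Qed.

Lemma svdE D2 D1 a P rho f g i : form_svd D2 D1 a P rho f g ->
  a (g i) (f i) = rho i.
Proof.
move=> A; rewrite (svdEl _ A (svd_D1 A i)) (svd_f A) eqxx/=.
by case: (boolP (P i)) => Pi; rewrite ?mulr1// (svd_out A)// mul0r.
Qed.

(** The bathtub principle with remainder: the mass placed beyond [k] is at most [k] minus the mass
    of the first [k] terms, and is worth at most [rho k] per unit. *)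
Lemma weighted_sum_le (rho v : nat -> R) k n : (k <= n)%N ->
  (forall l, 0 <= rho l) -> (forall i l, (i <= l)%N -> rho l <= rho i) ->
  (forall l, 0 <= v l) -> \sum_(l < n) v l <= k%:R ->
  \sum_(l < n) rho l * v l
    <= \sum_(l < k) rho l - \sum_(l < k) (rho l - rho k) * (1 - v l).
Proof.
move=> kn rho0 rhoD v0 vk.
rewrite -!(big_mkord xpredT (fun l => v l)) in vk.
rewrite -(big_mkord xpredT (fun l => rho l * v l)).
move: vk; rewrite !(big_cat_nat (leq0n k) kn)/= => vk.
have tail : \sum_(k <= l < n) rho l * v l <= rho k * \sum_(k <= l < n) v l.
  rewrite mulr_sumr !big_nat; apply: ler_sum => l /andP[kl _].
  by apply: ler_wpM2r => //; exact: rhoD.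
have tail' : rho k * \sum_(k <= l < n) v l
    <= rho k * (k%:R - \sum_(0 <= l < k) v l).
  by apply: ler_wpM2l => //; lra.
have -> : \sum_(l < k) rho l - \sum_(l < k) (rho l - rho k) * (1 - v l)
    = \sum_(0 <= l < k) rho l * v l
      + rho k * (k%:R - \sum_(0 <= l < k) v l).
  rewrite !big_mkord -sumrB mulrBr mulr_sumr.
  have -> : rho k * k%:R = \sum_(l < k) rho k.
    by rewrite sumr_const card_ord mulr_natr.
  rewrite -sumrB -big_split/=; apply: eq_bigr => l _; ring.
by lra.
Qed.

(** The mean of the two squares dominates the product of coefficients occurring in the form, and by
    Bessel it still has row and column sums at most one. *)
Definition overlap f g u v (l i : nat) : R :=
  (ip (f l) (v i) ^+ 2 + ip (g l) (u i) ^+ 2) / 2.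

Lemma overlap_ge0 f g u v l i : 0 <= overlap f g u v l i.
Proof. by rewrite /overlap divr_ge0// addr_ge0// sqr_ge0. Qed.

Lemma overlapC f g u v l i : overlap f g u v l i = overlap v u g f i l.
Proof. by rewrite /overlap (ipC (f l)) (ipC (g l)). Qed.

Lemma overlap_suml P Q f g u v i n : porth P f -> porth P g ->
  porth Q u -> porth Q v -> \sum_(l < n) overlap f g u v l i <= 1.
Proof.
move=> Pf Pg Qu Qv; rewrite -mulr_suml big_split/=.
have := bessel n (v i) Pf; have := bessel n (u i) Pg.
have := porth_le1 i Qu; have := porth_le1 i Qv; lra.
Qed.

Lemma overlap_sumr P Q f g u v l n : porth P f -> porth P g ->
  porth Q u -> porth Q v -> \sum_(i < n) overlap f g u v l i <= 1.
Proof.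
move=> Pf Pg Qu Qv; under eq_bigr do rewrite overlapC.
exact: (@overlap_suml Q P).
Qed.

(** Compares only the spans of the first [k] vectors and is blind to rotations inside them, so equal
    singular values before [k] do no harm. *)
Definition deficit f g u v k : R :=
  \sum_(l < k) (1 - \sum_(i < k) overlap f g u v l i).

Lemma deficit_ge0 P Q f g u v k : porth P f -> porth P g ->
  porth Q u -> porth Q v -> 0 <= deficit f g u v k.
Proof.
move=> Pf Pg Qu Qv; apply: sumr_ge0 => l _; rewrite subr_ge0.
exact: (@overlap_sumr P Q).
Qed.

(** By the inequality between the geometric and arithmetic means the form is at most the sum of
    [rho l] times the [l]-th row sum of [overlap]. These row sums total at most [k], so the bathtub
    bound applies to each partial sum of the decomposition and passes to the limit. *)
Lemma ky_fan D2 D1 a P rho f g Q u v k : form_svd D2 D1 a P rho f g ->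
  (forall i, D2 (u i)) -> (forall i, D1 (v i)) -> porth Q u -> porth Q v ->
  \sum_(i < k) a (u i) (v i) <= \sum_(l < k) rho l
    - \sum_(l < k) (rho l - rho k) * (1 - \sum_(i < k) overlap f g u v l i).
Proof.
move=> A Dx Dy Qu Qv.
have cv : (\sum_(i < k) \sum_(l < n) rho l * ip (g l) (u i) * ip (f l) (v i))
    @[n --> \oo] --> \sum_(i < k) a (u i) (v i).
  apply: cvg_big => [|i _]; [exact: add_continuous|exact: (svd_cvg A)].
apply: (cvgr_to_le cv); near=> n.
have kn : (k <= n)%N by near: n; exact: nbhs_infty_ge.
rewrite exchange_big/=.
apply: (le_trans (y := \sum_(l < n) rho l * \sum_(i < k) overlap f g u v l i)).
  apply: ler_sum => l _; rewrite mulr_sumr; apply: ler_sum => i _.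
  rewrite -mulrA; apply: ler_wpM2l; first exact: (svd_ge0 A).
  have := sqr_ge0 (ip (f l) (v i) - ip (g l) (u i)); rewrite /overlap; lra.
apply: (@weighted_sum_le rho (fun l => \sum_(i < k) overlap f g u v l i) k n kn).
- exact: (svd_ge0 A).
- exact: (svd_mono A).
- by move=> l; apply: sumr_ge0 => i _; exact: overlap_ge0.
rewrite exchange_big/=.
apply: (le_trans (y := \sum_(i < k) 1)); last by rewrite sumr_const card_ord.
apply: ler_sum => i _; exact: (overlap_suml _ _ (svd_f A) (svd_g A) Qu Qv).
Unshelve. all: by end_near. Qed.

Lemma ky_fan_le D2 D1 a P rho f g Q u v k : form_svd D2 D1 a P rho f g ->
  (forall i, D2 (u i)) -> (forall i, D1 (v i)) -> porth Q u -> porth Q v ->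
  \sum_(i < k) a (u i) (v i) <= \sum_(l < k) rho l.
Proof.
move=> A Dx Dy Qu Qv; apply: (le_trans (ky_fan k A Dx Dy Qu Qv)).
rewrite lerBlDr lerDl; apply: sumr_ge0 => l _; apply: mulr_ge0.
  by rewrite subr_ge0; apply: (svd_mono A); exact: ltnW.
by rewrite subr_ge0; exact: (overlap_sumr _ _ (svd_f A) (svd_g A) Qu Qv).
Qed.

(** Passing from the block of size [j] to size [j.+1] adds a border row and column. As row and
    column sums are at most one, each off-diagonal border sum is at most the deficit of the smaller
    block. *)
Lemma overlap_diag_ge P Q f g u v j : porth P f -> porth P g ->
  porth Q u -> porth Q v ->
  1 - overlap f g u v j j <= deficit f g u v j + deficit f g u v j.+1.
Proof.
move=> Pf Pg Qu Qv; set t := overlap f g u v.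
have -> : deficit f g u v j.+1 = deficit f g u v j
    - \sum_(l < j) t l j + (1 - \sum_(i < j) t j i - t j j).
  rewrite {1}/deficit big_ord_recr/=; congr (_ + _); last first.
    by rewrite big_ord_recr/= opprD addrA.
  rewrite -sumrB; apply: eq_bigr => l _.
  by rewrite big_ord_recr/= opprD addrA.
have h1 : \sum_(l < j) t l j <= deficit f g u v j.
  apply: ler_sum => l _.
  by have := overlap_sumr l j.+1 Pf Pg Qu Qv; rewrite big_ord_recr/= -/t; lra.
have h2 : \sum_(i < j) t j i <= deficit f g u v j.
  have -> : deficit f g u v j = \sum_(i < j) (1 - \sum_(l < j) t l i).
    by rewrite /deficit !sumrB exchange_big.
  apply: ler_sum => i _.
  by have := overlap_suml i j.+1 Pf Pg Qu Qv; rewrite big_ord_recr/= -/t; lra.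
by lra.
Qed.

(** * Singular vectors of weakly convergent forms *)

Section SingularVectors.
Context (D2 D1 : set V) (a : V -> V -> R) (am : nat -> V -> V -> R).
Context (P : pred nat) (rho : nat -> R) (f g : nat -> V).
Context (Pm : nat -> pred nat) (rhom : nat -> nat -> R) (fm gm : nat -> nat -> V).
Context (svda : form_svd D2 D1 a P rho f g).
Context (svdm : \forall m \near \oo,
  form_svd D2 D1 (am m) (Pm m) (rhom m) (fm m) (gm m)).
Context (am_cvg : forall x y, D2 x -> D1 y -> am m x y @[m --> \oo] --> a x y).
Context (am_eq : \forall m \near \oo, forall i,
  am m (gm m i) (fm m i) = a (gm m i) (fm m i)).

Lemma deficit_cvg0 k : (0 < k)%N -> rho k < rho k.-1 ->
  deficit f g (gm m) (fm m) k @[m --> \oo] --> (0 : R).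
Proof.
move=> k0 gap.
have eps0 : 0 < rho k.-1 - rho k by rewrite subr_gt0.
(* The majorant that [h1] to [h4] below yield after division by the gap. *)
have cv : (rho k.-1 - rho k)^-1 * \sum_(l < k) (rho l - am m (g l) (f l))
    @[m --> \oo] --> (0 : R).
  rewrite -[X in _ --> X](mulr0 (rho k.-1 - rho k)^-1).
  apply: cvgM; first exact: cvg_cst.
  rewrite -[X in _ --> X](_ : \sum_(l < k) (rho l - a (g l) (f l)) = _).
    apply: cvg_big => [|l _]; [exact: add_continuous|apply: cvgB]; first exact: cvg_cst.
    by apply: am_cvg; [exact: (svd_D2 svda)|exact: (svd_D1 svda)].
  by rewrite big1// => l _; rewrite (svdE _ svda) subrr.
apply: (squeeze_cvgr _ (cvg_cst 0) cv).
near=> m.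
have Am : form_svd D2 D1 (am m) (Pm m) (rhom m) (fm m) (gm m).
  by near: m.
have amE : forall i, am m (gm m i) (fm m i) = a (gm m i) (fm m i) by near: m.
apply/andP; split.
  exact: (deficit_ge0 _ (svd_f svda) (svd_g svda) (svd_g Am) (svd_f Am)).
rewrite mulrC ler_pdivlMr// mulrC.
have h1 := ky_fan_le k Am (svd_D2 svda) (svd_D1 svda) (svd_g svda) (svd_f svda).
have h2 := ky_fan k svda (svd_D2 Am) (svd_D1 Am) (svd_g Am) (svd_f Am).
have h3 : \sum_(l < k) rhom m l = \sum_(i < k) a (gm m i) (fm m i).
  by apply: eq_bigr => i _; rewrite -amE (svdE _ Am).
(* For [l < k] one has [rho k.-1 <= rho l], so the gap at [k] bounds every coefficient of the
   remainder from below. *)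
have h4 : (rho k.-1 - rho k) * deficit f g (gm m) (fm m) k <=
    \sum_(l < k) (rho l - rho k) *
      (1 - \sum_(i < k) overlap f g (gm m) (fm m) l i).
  rewrite mulr_sumr; apply: ler_sum => l _; apply: ler_wpM2r.
    rewrite subr_ge0.
    exact: (overlap_sumr _ _ (svd_f svda) (svd_g svda) (svd_g Am) (svd_f Am)).
  rewrite lerD2r; apply: (svd_mono svda).
  by rewrite -ltnS prednK.
by rewrite sumrB; lra.
Unshelve. all: by end_near. Qed.

Lemma deficit0 u v : deficit f g u v 0 = 0.
Proof. by rewrite /deficit big_ord0. Qed.

Lemma singular_vectors_cvg j : P j -> rho j.+1 < rho j ->
  ((0 < j)%N -> rho j < rho j.-1) ->
  (\forall m \near \oo, Pm m j -> 0 <= ip (fm m j) (f j) /\ 0 <= ip (gm m j) (g j)) ->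
  [/\ \forall m \near \oo, Pm m j,
      `|fm m j - f j| @[m --> \oo] --> (0 : R)
    & `|gm m j - g j| @[m --> \oo] --> (0 : R)].
Proof.
move=> Pj gap gap' sgn.
pose u m := deficit f g (gm m) (fm m) j + deficit f g (gm m) (fm m) j.+1.
have u0 : u m @[m --> \oo] --> (0 : R).
  rewrite -[X in _ --> X](addr0 0); apply: cvgD; last exact: deficit_cvg0.
  (* For [j = 0] there is no singular value above [rho j]; the empty deficit replaces the gap
     condition. *)
  have [->|j0] := posnP j; last exact: deficit_cvg0 (gap' j0).
  by under eq_fun do rewrite deficit0; exact: cvg_cst.
(* Let a and b be the inner products of the [j]-th vectors, in [0, 1] by the sign convention and
   Cauchy-Schwarz. From 1 - (a^2 + b^2) / 2 <= u follows 1 - a^2 <= 2 u, and the squared distance is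
   2 (1 - a) <= 2 (1 - a^2) <= 4 u. *)
have bnd : \forall m \near \oo, [/\ Pm m j,
    `|fm m j - f j| ^+ 2 <= 4 * u m & `|gm m j - g j| ^+ 2 <= 4 * u m].
  have u1 : \forall m \near \oo, `|0 - u m| < 1 by move/cvgrPdist_lt : u0; apply.
  near=> m.
  have Am : form_svd D2 D1 (am m) (Pm m) (rhom m) (fm m) (gm m) by near: m.
  have um : `|0 - u m| < 1 by near: m.
  have sgnm : Pm m j -> 0 <= ip (fm m j) (f j) /\ 0 <= ip (gm m j) (g j) by near: m.
  have := overlap_diag_ge j (svd_f svda) (svd_g svda) (svd_g Am) (svd_f Am).
  rewrite -/(u m) => h.
  (* Outside [Pm m] the [j]-th vectors are zero, so the overlap vanishes and [u m] is at least 1. *)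
  have Pmj : Pm m j.
    apply/negPn/negP => nP; move: h; rewrite /overlap.
    rewrite (porth0 (svd_f Am) nP) (porth0 (svd_g Am) nP) !ip0r expr0n/=.
    by move: um; rewrite sub0r normrN ltr_norml => /andP[]; lra.
  have [af ag] := sgnm Pmj.
  have ff := svd_f Am j j; have gg := svd_g Am j j.
  have ff0 := svd_f svda j j; have gg0 := svd_g svda j j.
  rewrite !eqxx Pmj Pj/= in ff gg ff0 gg0.
  have n1 (x : V) : ip x x = 1 -> `|x| = 1 by rewrite norm_ip => ->; rewrite sqrtr1.
  have cf := ip_CS (fm m j) (f j); have cg := ip_CS (gm m j) (g j).
  rewrite (n1 _ ff) (n1 _ ff0) mulr1 ler_norml in cf.
  rewrite (n1 _ gg) (n1 _ gg0) mulr1 ler_norml in cg.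
  rewrite /overlap (ipC (f j)) (ipC (g j)) in h.
  rewrite -!(ip_norm ipV) !ipBl !ipBr ff gg ff0 gg0 (ipC (f j)) (ipC (g j)).
  case/andP: cf => _ cf; case/andP: cg => _ cg.
  by split => //; nra.
have sq0 : Num.sqrt (4 * u m) @[m --> \oo] --> (0 : R).
  apply: sqrt_cvg0; rewrite -[X in _ --> X](mulr0 4).
  by apply: cvgM => //; exact: cvg_cst.
split; first by apply: filterS bnd => m [].
  apply: (squeeze_cvgr _ (cvg_cst 0) sq0); apply: filterS bnd => m [_ h _].
  by rewrite normr_ge0/= -(ger0_norm (normr_ge0 (fm m j - f j))) -sqrtr_sqr ler_wsqrtr.
apply: (squeeze_cvgr _ (cvg_cst 0) sq0); apply: filterS bnd => m [_ _ h].
by rewrite normr_ge0/= -(ger0_norm (normr_ge0 (gm m j - g j))) -sqrtr_sqr ler_wsqrtr.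
Unshelve. all: by end_near. Qed.

End SingularVectors.
End InnerProduct.

(** * Diagonal operators and eigenprojections *)

Section DiagonalOperators.
Context (R : realType) (V : normedModType R) (ip : V -> V -> R).
Context (ipV : inner_product ip).
Implicit Types (x y z : V) (A B : V -> V) (P : pred nat) (e : nat -> V).
Implicit Types (c : nat -> R).

Local Notation whole := (whole_space ip).

Lemma nrm_whole x : nrm whole x = `|x|.
Proof. by rewrite (norm_ip ipV). Qed.

Lemma norm_porth P e i : porth ip P e -> `|e i| <= 1.
Proof.
move=> eP; rewrite (norm_ip ipV) -(sqrtr1 R) ler_wsqrtr//.
exact: (porth_le1 _ eP).
Qed.

Lemma diag_lin e c n (a : R) x y :
  diag ip e c n (a *: x + y) = a *: diag ip e c n x + diag ip e c n y.
Proof.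
rewrite /diag scaler_sumr -big_split/=; apply: eq_bigr => i _.
by rewrite (ipDr ipV) (ipZr ipV) scalerA -scalerDl; congr (_ *: _); ring.
Qed.

Lemma diagB e c n x y :
  diag ip e c n (x - y) = diag ip e c n x - diag ip e c n y.
Proof. by rewrite addrC -scaleN1r diag_lin scaleN1r addrC. Qed.

Lemma diag_bounded P e c n : porth ip P e ->
  bounded_operator whole whole (diag ip e c n).
Proof.
move=> eP; split=> // [a x y _ _|]; first exact: diag_lin.
exists (\sum_(i < n) `|c i|) => x _; rewrite !nrm_whole mulr_suml.
apply: le_trans (ler_norm_sum _ _ _) _; apply: ler_sum => i _.
rewrite normrZ normrM -mulrA; apply: ler_wpM2l => //.
have e1 := norm_porth i eP; have := ip_CS ipV (e i) x.
have := normr_ge0 x; have := normr_ge0 (e i); have := normr_ge0 (ip (e i) x); nra.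
Qed.

Lemma diag_self_adjoint e c n : self_adjoint ip (diag ip e c n).
Proof. by split=> // x y _ _; exact: (diag_sym ipV). Qed.

(** [A \o B] and [A \o B'] are both the orthogonal projection onto the range of [A], hence equal; a
    symmetric argument gives [B \o A = B' \o A]. Then B = BAB = BAB' = B'AB' = B'. *)
Lemma is_mp_inverse_uniq A B B' :
  is_mp_inverse ip A B -> is_mp_inverse ip A B' -> B = B'.
Proof.
case=> _ h1 h2 [_ h3] [_ h4] [_ h1' h2' [_ h3'] [_ h4']].
have AB x : A (B x) = A (B' x).
  apply: (ipext ipV) => y.
  have -> : A (B x) = A (B' (A (B x))).
    by rewrite -[in LHS]h1'.
  have := h3' (A (B x)) y I I; rewrite /= => ->.
  have := h3 x (A (B' y)) I I; rewrite /= => ->.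
  rewrite -[A (B (A _))]/((A \o B \o A) (B' y)) h1.
  by have := h3' x y I I; rewrite /= => ->.
have BA x : B (A x) = B' (A x).
  apply: (ipext ipV) => y.
  have -> : B (A x) = B (A (B' (A x))).
    by rewrite -[in LHS]h1'.
  have := h4 (B' (A x)) y I I; rewrite /= => ->.
  have := h4' x (B (A y)) I I; rewrite /= => ->.
  rewrite -[A (B (A y))]/((A \o B \o A) y) h1.
  by have := h4' x y I I; rewrite /= => ->.
apply/funext => x; rewrite -h2 -[in RHS]h2' /=.
by rewrite AB BA.
Qed.

(** The convention that the inverse of 0 is 0 makes the formula right on the kernel as well. *)
Lemma mp_inverse_diag P e c n : porth ip P e ->
  mp_inverse ip (diag ip e c n) = diag ip e (fun k => (c k)^-1) n.
Proof.
move=> eP; set B := diag ip e (fun k => (c k)^-1) n.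
have cc (k : nat) : c k * (c k)^-1 * c k = c k.
  by have [->|c0] := eqVneq (c k) 0; rewrite ?mulr0// mulfV// mul1r.
have Bmp : is_mp_inverse ip (diag ip e c n) B.
  split; first exact: (diag_bounded _ _ eP).
  - rewrite !(diag_comp ipV _ _ _ eP); apply: (eq_diag ipV eP) => k _ _.
    exact: cc.
  - rewrite !(diag_comp ipV _ _ _ eP); apply: (eq_diag ipV eP) => k _ _.
    have [->|c0] := eqVneq (c k) 0; first by rewrite invr0 mulr0.
    by rewrite mulVf// mul1r.
  - by rewrite (diag_comp ipV _ _ _ eP); exact: diag_self_adjoint.
  - by rewrite (diag_comp ipV _ _ _ eP); exact: diag_self_adjoint.
exact: (is_mp_inverse_uniq (xgetPex _ (ex_intro _ _ Bmp)) Bmp).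
Qed.

Section SquareRoot.
Context (A B : V -> V) (AB : is_sqrt_op ip A B).

Let B_lin a x y : B (a *: x + y) = a *: B x + B y.
Proof. by case: AB => -[_ + _] _ _ _; apply. Qed.

Let B_sym x y : ip (B x) y = ip x (B y).
Proof. by case: AB => _ [_ +] _ _; apply. Qed.

Let BB x : B (B x) = A x.
Proof. by case: AB => _ _ _ <-. Qed.

Lemma sqrt_op_ker x : A x = 0 -> B x = 0.
Proof. by move=> Ax; apply: (ip_eq0 ipV); rewrite B_sym BB Ax (ip0r ipV). Qed.

(** The vector [v = B x - s x] satisfies [B v = - s v], which positivity of [B] allows only for
    [v = 0]. *)
Lemma sqrt_op_eigenvector x (mu : R) : 0 <= mu -> A x = mu *: x ->
  B x = Num.sqrt mu *: x.
Proof.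
rewrite le_eqVlt => /orP[/eqP<-|mu0 Ax].
  by rewrite scale0r => /sqrt_op_ker ->; rewrite sqrtr0 scale0r.
set s := Num.sqrt mu; have s0 : 0 < s by rewrite sqrtr_gt0.
pose v := - s *: x + B x.
have Bv : B v = - s *: v.
  rewrite B_lin BB Ax /v scalerDr scalerA mulrNN -expr2 sqr_sqrtr ?ltW//.
  by rewrite addrC.
have : 0 <= ip (B v) v by case: AB => _ _ + _; apply.
rewrite Bv (ipZl ipV) mulNr oppr_ge0 pmulr_rle0// => vv.
have : v = 0 by apply: (ip_eq0 ipV); apply/eqP; rewrite eq_le vv (ip_ge0 ipV).
by move/eqP; rewrite /v addrC scaleNr subr_eq0 => /eqP.
Qed.

End SquareRoot.

(** Any positive square root has prescribed values on the eigenvectors [e i] and kills the kernel of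
    the operator. The residual [z] of [y] lies in that kernel, so the chosen root agrees with the
    diagonal one. *)
Lemma sqrt_op_diag P e c n : porth ip P e -> (forall k, P k -> 0 <= c k) ->
  sqrt_op ip (diag ip e c n) = diag ip e (fun k => Num.sqrt (c k)) n.
Proof.
move=> eP c0; set B' := diag ip e (fun k => Num.sqrt (c k)) n.
have BB' : is_sqrt_op ip (diag ip e c n) B'.
  split; first exact: (diag_bounded _ _ eP).
  - exact: diag_self_adjoint.
  - move=> x; rewrite (ip_diag ipV); apply: sumr_ge0 => i _.
    by rewrite -mulrA -expr2 mulr_ge0// ?sqrtr_ge0// sqr_ge0.
  - rewrite (diag_comp ipV _ _ _ eP); apply: (eq_diag ipV eP) => k _ Pk.
    by rewrite -expr2 sqr_sqrtr// c0.
set B := sqrt_op _ _; have BP : is_sqrt_op ip (diag ip e c n) B.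
  exact: xgetPex (ex_intro _ _ BB').
have B_sym x y : ip (B x) y = ip x (B y).
  by case: BP => _ [_ +] _ _; apply.
apply/funext => x; apply: (ipext ipV) => y.
pose z := y - diag ip e (fun=> 1) n y.
have Bz : B z = 0.
  apply: (sqrt_op_ker BP); rewrite /z diagB.
  rewrite -[X in _ - X]/((diag ip e c n \o diag ip e (fun=> 1) n) y).
  rewrite (diag_comp ipV _ _ _ eP).
  have -> : (fun k => c k * 1) = c by apply/funext => k; rewrite mulr1.
  exact: subrr.
have {1}-> : y = diag ip e (fun=> 1) n y + z by rewrite addrC subrK.
rewrite (ipDr ipV) (B_sym _ z) Bz (ip0r ipV) addr0 /B' (ip_diag ipV).
rewrite (ip_sumr ipV); apply: eq_bigr => i _.
rewrite (ipZr ipV) mul1r B_sym.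
case: (boolP (P i)) => Pi; last first.
  by rewrite (porth0 ipV eP Pi) !(ip0l ipV) !(mul0r, mulr0).
rewrite (@sqrt_op_eigenvector _ _ BP (e i) (c i)) ?c0//; last first.
  exact: (diag_basis ipV _ eP).
by rewrite (ipZr ipV) (ipC ipV x); ring.
Qed.

Definition lin_subspace (D : set V) :=
  D 0 /\ forall (a : R) x y, D x -> D y -> D (a *: x + y).

Lemma lin_subspaceD D x y : lin_subspace D -> D x -> D y -> D (x + y).
Proof. by move=> [_ h] Dx Dy; have := h 1 x y Dx Dy; rewrite scale1r. Qed.

Lemma lin_subspaceZ D (a : R) x : lin_subspace D -> D x -> D (a *: x).
Proof. by move=> [D0 h] Dx; have := h a x 0 Dx D0; rewrite addr0. Qed.

Lemma lin_subspaceB D x y : lin_subspace D -> D x -> D y -> D (x - y).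
Proof. by move=> [_ h] Dx Dy; have := h (-1) y x Dy Dx; rewrite scaleN1r addrC. Qed.

Lemma lin_subspace_diag D e c n x : lin_subspace D -> (forall k, D (e k)) ->
  D (diag ip e c n x).
Proof.
move=> sD De; apply: (@big_rec _ D); first by case: sD.
by move=> i y _ Dy; apply: lin_subspaceD => //; exact: lin_subspaceZ.
Qed.

Lemma ipext_in D x y : lin_subspace D -> D x -> D y ->
  (forall z, D z -> ip x z = ip y z) -> x = y.
Proof.
move=> sD Dx Dy xy; apply/eqP; rewrite -subr_eq0; apply/eqP/(ip_eq0 ipV).
by rewrite (ipBl ipV) xy ?subrr//; exact: lin_subspaceB.
Qed.

Lemma orthproj_eq D x u : lin_subspace D -> D u ->
  (forall v, D v -> ip (x - u) v = 0) -> orthproj ip D x = u.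
Proof.
move=> sD Du xu.
have [Dw xw] := @xgetPex _ 0 [set u | D u /\ forall v, D v -> ip (x - u) v = 0]
  (ex_intro _ u (conj Du xu)).
apply: (ipext_in sD Dw Du) => z Dz.
have := xw z Dz; have := xu z Dz; rewrite !(ipBl ipV) /orthproj; lra.
Qed.

End DiagonalOperators.

(** * Levels of distinct eigenvalues and the truncating projections *)

Section EigenBasis.
Local Open Scope card_scope.
Context (R : realType) (V : normedModType R) (ip : V -> V -> R).
Context (ipV : inner_product ip).
Context (D : set V) (A : V -> V) (N : option nat) (lam : nat -> R) (phi : nat -> V).
Context (sD : lin_subspace D) (AD : forall x, D (A x)).
Context (A_sym : forall x y, ip (A x) y = ip x (A y)).
Context (eb : eigenbasis ip D A N lam phi).
Implicit Types (x y z : V).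

Local Notation W := (InnerSpace D ip).

Definition zero_ext (M : zmodType) (u : nat -> M) k := if idx N k then u k else 0.

Local Notation ph := (zero_ext phi).

Lemma idx_le j k : (j <= k)%N -> idx N k -> idx N j.
Proof. by rewrite /idx; case: N => // n; exact: leq_ltn_trans. Qed.

Lemma porth_zero_ext (e : nat -> V) :
  (forall j k, idx N j -> idx N k -> ip (e j) (e k) = (j == k)%:R) ->
  porth ip (idx N) (zero_ext e).
Proof.
move=> eN i j; rewrite /zero_ext; case: (boolP (idx N i)) => Ni; last first.
  by rewrite (ip0l ipV) andbF.
case: (boolP (idx N j)) => Nj; first by rewrite eN// andbT.
by rewrite (ip0r ipV) andbT (_ : i == j = false)//; apply: contraNF Nj => /eqP <-.
Qed.

Lemma porth_eigenbasis : porth ip (idx N) ph.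
Proof. by apply: porth_zero_ext; case: eb => [[[_ h] _] _ _ _]. Qed.

Let phP := porth_eigenbasis.

Lemma D_eigenbasis k : D (ph k).
Proof.
rewrite /zero_ext; case: ifP => [Nk|_]; last by case: sD.
by case: eb => [[[h _] _] _ _ _]; exact: h.
Qed.

Lemma A_eigenbasis k : A (ph k) = lam k *: ph k.
Proof.
have A0 : A 0 = 0.
  by apply: (ipext ipV) => z; rewrite A_sym !(ip0l ipV).
rewrite /zero_ext; case: ifP => [Nk|_]; last by rewrite scaler0.
by case: eb => [_ h _ _]; exact: h.
Qed.

Lemma partial_sum_basis x n :
  partial_sum N (fun k => tensor W (phi k) (phi k) x) n
  = diag ip ph (fun=> 1) n x.
Proof.
rewrite /partial_sum big_mkcond big_mkord; apply: eq_bigr => k _.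
by rewrite /tensor/= /zero_ext; case: ifP; rewrite ?mul1r// scaler0.
Qed.

Lemma basis_cvg x : D x ->
  `|x - diag ip ph (fun=> 1) n x| @[n --> \oo] --> (0 : R).
Proof.
move=> Dx; case: eb => [[_ /(_ x Dx) h] _ _ _].
apply: cvg_trans h; apply: near_eq_cvg; near=> n.
by rewrite partial_sum_basis (norm_ip ipV).
Unshelve. all: by end_near. Qed.

Lemma basis_eq0 x : D x -> (forall k, ip (ph k) x = 0) -> x = 0.
Proof.
move=> Dx x0; apply/eqP; rewrite -normr_eq0; apply/eqP.
apply: (cvg_unique _ _ (basis_cvg Dx)) => //.
apply: cvg_near_cst; near=> n.
by rewrite /diag big1 ?subr0// => k _; rewrite x0 mulr0 scale0r.
Unshelve. all: by end_near. Qed.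

Lemma basis_coefA x k : ip (ph k) (A x) = lam k * ip (ph k) x.
Proof. by rewrite -A_sym A_eigenbasis (ipZl ipV). Qed.

Lemma A_diag c n x :
  A (diag ip ph c n x) = diag ip ph (fun k => lam k * c k) n x.
Proof.
apply: (ipext ipV) => y; rewrite A_sym !(ip_diag ipV).
by apply: eq_bigr => i _; rewrite basis_coefA; ring.
Qed.

Lemma eigenvalue_lam mu :
  eigenvalue_on W A mu <-> exists2 k, idx N k & mu = lam k.
Proof.
split=> [[x [/= Dx x0 Ax]]|[k Nk ->]].
  apply: contra_notP x0 => /forall2NP noev; apply: basis_eq0 => // k.
  case: (noev k) => [/negP Nk|muk].
    by rewrite (porth0 ipV phP Nk) (ip0l ipV).
  have := basis_coefA x k; rewrite Ax (ipZr ipV) => /eqP.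
  by rewrite -subr_eq0 -mulrBl mulf_eq0 subr_eq0 => /orP[/eqP//|/eqP].
have pk : ph k = phi k by rewrite /zero_ext Nk.
exists (phi k); rewrite -pk; split; [exact: D_eigenbasis| |exact: A_eigenbasis].
move=> p0; have := phP k k; rewrite p0 (ip0l ipV) eqxx Nk => /eqP.
by rewrite eq_sym oner_eq0.
Qed.

Let lamD j k : (j <= k)%N -> idx N k -> lam k <= lam j.
Proof. by case: eb => _ _ _; apply. Qed.

(* The number of distinct eigenvalues larger than [lam k]. *)
Fixpoint level k : nat :=
  if k is k'.+1 then (level k' + (lam k'.+1 != lam k'))%N else 0%N.

Lemma level_le k : (level k <= k)%N.
Proof. by elim: k => //= k; case: (_ != _); rewrite ?addn1 ?addn0// => /leqW. Qed.

Lemma level_mono j k : (j <= k)%N -> (level j <= level k)%N.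
Proof.
elim: k => [|k IH]; first by rewrite leqn0 => /eqP ->.
rewrite leq_eqVlt => /orP[/eqP -> //|]; rewrite ltnS => /IH jk /=.
exact: leq_trans jk (leq_addr _ _).
Qed.

Lemma level_inj j k : idx N j -> idx N k -> level j = level k -> lam j = lam k.
Proof.
wlog jk : j k / (j <= k)%N.
  move=> h Nj Nk l; have [/h|/ltnW/h h'] := leqP j k; first exact.
  exact/esym/h'.
move=> _; elim: k jk => [|k IH]; first by rewrite leqn0 => /eqP ->.
rewrite leq_eqVlt => /orP[/eqP -> //|]; rewrite ltnS => jk Nk l.
have := level_mono jk; move: l => /=; case: eqP => /= [-> |_].
  by rewrite addn0 => l _; apply: IH => //; exact: (idx_le _ Nk).
by move=> ->; rewrite addn1 ltnn.
Qed.

(** Induction on [k]: a strict drop after [k] adds exactly the value [lam k] to the set, and a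
    repeated eigenvalue leaves it unchanged. *)
Lemma level_set k : idx N k ->
  [set mu | eigenvalue_on W A mu /\ lam k < mu] #= `I_(level k).
Proof.
elim: k => [|k IH] Nk.
  rewrite (_ : [set _ | _] = set0) ?II0//.
  apply/seteqP; split=> // mu [/eigenvalue_lam [i Ni ->]].
  by rewrite ltNge (lamD (leq0n i) Ni).
have Nk' := idx_le (leqnSn k) Nk; move: (IH Nk') => {}IH /=.
case: eqP => [->|/eqP ne]; first by rewrite addn0.
have lt : lam k.+1 < lam k by rewrite lt_neqAle ne lamD.
rewrite addn1; apply/eq_cardSP; exists (lam k).
  by split=> //; apply/eigenvalue_lam; exists k.
rewrite (_ : _ `\ _ = [set mu | eigenvalue_on W A mu /\ lam k < mu])//.
apply/seteqP; split=> mu /=.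
  move=> [[ev lti] /eqP nei]; split=> //.
  have /eigenvalue_lam[i Ni mui] := ev; rewrite mui in lti nei *.
  have ik : (i <= k)%N.
    by rewrite leqNgt; apply/negP => ki; move: lti; rewrite ltNge (lamD ki Ni).
  by rewrite lt_neqAle eq_sym nei lamD.
move=> [ev ltmu]; split; first by split=> //; exact: lt_trans ltmu.
by move/eqP; rewrite gt_eqF.
Qed.

Lemma nth_eigenvalue_level k h : idx N k ->
  nth_eigenvalue W A h (lam k) <-> level k = h.
Proof.
move=> Nk; split=> [[_ ch]|<-].
  by apply/card_eq_II; apply: card_eq_trans ch; rewrite card_eq_sym; exact: level_set.
by split; [apply/eigenvalue_lam; exists k|exact: level_set].
Qed.

(** This description in coordinates also covers the default case: if no index has level [h], all
    coefficients vanish and both sides reduce to 0. *)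
Lemma nth_eigenspaceP h : nth_eigenspace W A h =
  [set x | D x /\ forall k, level k <> h -> ip (ph k) x = 0].
Proof.
apply/seteqP; split=> x /=.
  case=> [->|[mu nmu [Dx Ax]]]; first by split=> [|k _]; [case: sD|rewrite (ip0r ipV)].
  split=> // k lk; case: (boolP (idx N k)) => Nk; last first.
    by rewrite (porth0 ipV phP Nk) (ip0l ipV).
  have [muk|/eqP muk] := eqVneq (lam k) mu.
    by rewrite -muk in nmu; case: lk; apply/nth_eigenvalue_level.
  have := basis_coefA x k; rewrite Ax (ipZr ipV) => /eqP.
  rewrite -subr_eq0 -mulrBl mulf_eq0 subr_eq0 => /orP[/eqP h'|/eqP//].
  by case: muk.
move=> [Dx xh].
case: (pselect (exists2 k, idx N k & level k = h)) => [[k0 Nk0 lk0]|noh].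
  right; exists (lam k0); first by apply/nth_eigenvalue_level.
  split=> //; apply/eqP; rewrite -subr_eq0; apply/eqP.
  apply: basis_eq0 => [|k].
    by apply: (lin_subspaceB sD) => //; exact: (lin_subspaceZ _ sD).
  rewrite (ipBr ipV) (ipZr ipV) basis_coefA.
  have [lk|/eqP lk] := eqVneq (level k) h; last by rewrite xh// !mulr0 subrr.
  case: (boolP (idx N k)) => Nk; last first.
    by rewrite (porth0 ipV phP Nk) (ip0l ipV) !mulr0 subrr.
  by rewrite (@level_inj k k0)// ?subrr// lk.
left; apply: basis_eq0 => // k.
case: (boolP (idx N k)) => Nk; last by rewrite (porth0 ipV phP Nk) (ip0l ipV).
by apply: xh => lk; apply: noh; exists k.
Qed.

Lemma ip_ph_diag (c : nat -> R) n k x :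
  ip (ph k) (diag ip ph c n x) = (k < n)%:R * c k * ip (ph k) x.
Proof.
case: (ltnP k n) => kn.
  by rewrite -(diag_sym ipV) (diag_basis ipV _ phP kn) (ipZl ipV) mul1r.
rewrite mul0r mul0r (ip_sumr ipV) big1// => i _; rewrite (ipZr ipV) phP.
by rewrite (gtn_eqF (leq_trans (ltn_ord i) kn)) mulr0.
Qed.

(** The hypothesis puts all indices of level [h] below [K], so the projection is a finite diagonal
    operator. *)
Lemma eigenprojection_diag h K : (forall k, idx N k -> (K <= k)%N -> (h < level k)%N) ->
  eigenprojection ip D A h = diag ip ph (fun k => (level k == h)%:R) K.
Proof.
move=> hK; apply/funext => x; rewrite /eigenprojection nth_eigenspaceP.
apply: (orthproj_eq ipV).
- split; first by split=> [|k _]; [case: sD|rewrite (ip0r ipV)].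
  move=> a y z [Dy y0] [Dz z0]; split; first by case: sD => _; apply.
  by move=> k lk; rewrite (ipDr ipV) (ipZr ipV) y0// z0// mulr0 addr0.
- split; first by apply: (lin_subspace_diag _ _ _ _ sD); exact: D_eigenbasis.
  by move=> k /eqP/negbTE lk; rewrite ip_ph_diag lk mulr0 mul0r.
move=> v [Dv v0]; rewrite (ipBl ipV) (diag_sym ipV) -(ipBr ipV).
rewrite [X in ip x X](_ : _ = 0) ?(ip0r ipV)//; apply: basis_eq0 => [|k].
  by apply: (lin_subspaceB sD) => //; apply: (lin_subspace_diag _ _ _ _ sD); exact: D_eigenbasis.
rewrite (ipBr ipV) ip_ph_diag.
have [lk|/eqP lk] := eqVneq (level k) h; last by rewrite v0// !mulr0 subrr.
case: (boolP (idx N k)) => Nk; last first.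
  by rewrite (porth0 ipV phP Nk) (ip0l ipV) mulr0 subrr.
case: (ltnP k K) => kK; first by rewrite !mul1r subrr.
by have := hK k Nk kK; rewrite lk ltnn.
Qed.

Context (M : R) (trA : forall k, idx N k -> k.+1%:R * lam k <= M).

(** A positive eigenvalue cannot repeat forever under the trace bound. For a finite basis a [K] past
    the end makes the claim vacuous. *)
Lemma level_unbounded m : exists K, forall k, idx N k -> (K <= k)%N -> (m <= level k)%N.
Proof.
elim: m => [|m [K hK]]; first by exists 0%N.
case: (boolP (idx N K)) => NK; last first.
  by exists K => k Nk /idx_le /(_ Nk); rewrite (negbTE NK).
have lK : 0 < lam K by case: eb => _ _ + _; apply.
(* For [k >= L] one has [k.+1 * lam K > M], so the trace bound excludes [lam k = lam K]. *)
pose L := Num.trunc (M / lam K); exists (maxn K L) => k Nk.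
rewrite geq_max => /andP[Kk Lk].
apply: (leq_ltn_trans (hK K NK (leqnn K))); rewrite ltn_neqAle level_mono// andbT.
apply/eqP => /(level_inj NK Nk) lKk.
have := trA Nk; rewrite -lKk -ler_pdivlMr//; apply/negP; rewrite -ltNge.
have := Num.Theory.truncnS_gt (M / lam K); rewrite -/L => h.
by apply: lt_le_trans h _; rewrite ler_nat ltnS.
Qed.

Definition trunc (K : nat -> nat) m :=
  diag ip ph (fun k => (level k < m)%N%:R) (K m).

Lemma eigenprojection_sum : exists2 K : nat -> nat, forall m, (m <= K m)%N &
  forall m x, \sum_(h < m) eigenprojection ip D A h x = trunc K m x.
Proof.
have [K hK] := choice level_unbounded.
(* The maximum with [m] serves [trunc_cvg], where the truncation has to contain the first [m] basis
   vectors. *)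
exists (fun m => maxn m (K m)) => [m|m x]; first exact: leq_maxl.
rewrite /trunc; set Km := maxn _ _.
have hKm k : idx N k -> (Km <= k)%N -> (m <= level k)%N.
  by move=> Nk; rewrite geq_max => /andP[_]; exact: hK.
transitivity (\sum_(h < m) diag ip ph (fun k => (level k == h)%:R) Km x).
  apply: eq_bigr => h _; rewrite (@eigenprojection_diag h Km)// => k Nk kK.
  exact: leq_trans (hKm k Nk kK).
rewrite exchange_big/=; apply: eq_bigr => i _.
rewrite -scaler_suml -mulr_suml; congr (_ * _ *: _).
case: (ltnP (level i) m) => lm; last first.
  by rewrite big1// => h _; rewrite (gtn_eqF (leq_trans (ltn_ord h) lm)).
rewrite (bigD1 (Ordinal lm))//= eqxx big1 ?addr0// => h /negPf hl.
by rewrite eq_sym (_ : _ == _ = false).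
Qed.

(** Since [level k <= k], the truncation keeps at least the first [m] basis vectors; by Pythagoras
    its error is at most that of the [m]-th partial sum of the expansion. *)
Lemma trunc_cvg K x : (forall m, (m <= K m)%N) -> D x ->
  `|x - trunc K m x| @[m --> \oo] --> (0 : R).
Proof.
move=> mK Dx; apply: (squeeze_cvgr _ (cvg_cst 0) (basis_cvg Dx)).
have sq n (c : nat -> R) : (forall k, c k * c k = c k) ->
    ip (x - diag ip ph c n x) (x - diag ip ph c n x)
    = ip x x - \sum_(i < n) c i * ip (ph i) x ^+ 2.
  move=> cc; have dd : ip (diag ip ph c n x) x = \sum_(i < n) c i * ip (ph i) x ^+ 2.
    by rewrite (ip_diag ipV); apply: eq_bigr => i _; rewrite -mulrA.
  have ddd : ip (diag ip ph c n x) (diag ip ph c n x) = ip (diag ip ph c n x) x.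
    rewrite -(diag_sym ipV) -[X in ip X x]/((diag ip ph c n \o diag ip ph c n) x).
    rewrite (diag_comp ipV _ _ _ phP).
    by rewrite (_ : (fun k => c k * c k) = c)//; apply/funext.
  by rewrite (ipBl ipV) !(ipBr ipV) ddd (ipC ipV x (diag _ _ _ _ _)) dd; ring.
near=> m; rewrite normr_ge0/= !(norm_ip ipV) ler_wsqrtr//.
rewrite (sq m (fun=> 1)); last by move=> k; rewrite mulr1.
rewrite /trunc sq; last by move=> k; case: (_ < _)%N; rewrite ?mulr0 ?mulr1.
rewrite lerD2l lerN2.
have lem : forall i : 'I_m, (level i < m)%N by move=> i; exact: leq_ltn_trans (level_le i) _.
rewrite -(big_mkord xpredT (fun i => (level i < m)%N%:R * ip (ph i) x ^+ 2)).
rewrite (big_cat_nat (leq0n m) (mK m))/= big_mkord.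
have -> : \sum_(i < m) 1 * ip (ph i) x ^+ 2 =
    \sum_(i < m) (level i < m)%N%:R * ip (ph i) x ^+ 2.
  by apply: eq_bigr => i _; rewrite lem.
by rewrite lerDl; apply: sumr_ge0 => i _; rewrite mulr_ge0// sqr_ge0.
Unshelve. all: by end_near. Qed.

End EigenBasis.

(** * Reproducing kernel spaces *)

(** The default value of [sqrt_op] is the zero map, so a single nonzero value certifies that a
    square root exists. *)
Lemma sqrt_op_exists (R : realType) (V : normedModType R) (ip : V -> V -> R)
    (A : V -> V) x : sqrt_op ip A x <> 0 -> is_sqrt_op ip A (sqrt_op ip A).
Proof. by rewrite /sqrt_op; case: xgetP. Qed.

Section ReproducingKernel.
Context (R : realType) (V : normedModType R) (ip : V -> V -> R).
Context (ipV : inner_product ip).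
Context (D : set V) (A : V -> V) (N : option nat) (lam : nat -> R) (phi : nat -> V).
Context (sD : lin_subspace D).
Context (A_sym : forall x y, ip (A x) y = ip x (A y)).
Context (eb : eigenbasis ip D A N lam phi).
Context (AB : is_sqrt_op ip A (sqrt_op ip A)).
Context (D_dec : forall x, exists x1 x2, [/\ D x1, A x2 = 0 & x = x1 + x2]).

Local Notation B := (sqrt_op ip A).
Local Notation K := (rkhs ip A N lam phi).
Local Notation ph := (zero_ext N phi).

Lemma sqrt_op_lin (a : R) x y : B (a *: x + y) = a *: B x + B y.
Proof. by case: AB => -[_ + _] _ _ _; apply. Qed.

Lemma sqrt_op_sym x y : ip (B x) y = ip x (B y).
Proof. by case: AB => _ [_ +] _ _; apply. Qed.

Lemma sqrt_op0 : B 0 = 0.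
Proof.
by apply: (ipext ipV) => z; rewrite sqrt_op_sym !(ip0l ipV).
Qed.

Lemma sqrt_opD x y : B (x + y) = B x + B y.
Proof. by have := sqrt_op_lin 1 x y; rewrite !scale1r. Qed.

Lemma sqrt_opZ (a : R) x : B (a *: x) = a *: B x.
Proof. by have := sqrt_op_lin a x 0; rewrite sqrt_op0 !addr0. Qed.

Lemma sqrt_opB x y : B (x - y) = B x - B y.
Proof. by rewrite -scaleN1r sqrt_opD sqrt_opZ scaleN1r. Qed.

Lemma sqrt_op_sum I (s : seq I) (p : pred I) (u : I -> V) :
  B (\sum_(i <- s | p i) u i) = \sum_(i <- s | p i) B (u i).
Proof. by apply: big_morph; [exact: sqrt_opD|exact: sqrt_op0]. Qed.

Lemma sqrt_op_basis k : B (ph k) = Num.sqrt (lam k) *: ph k.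
Proof.
case: (boolP (idx N k)) => Nk; last first.
  by rewrite (porth0 ipV (porth_eigenbasis ipV eb) Nk) sqrt_op0 scaler0.
apply: (sqrt_op_eigenvector ipV AB); last exact: (A_eigenbasis ipV A_sym eb).
by apply: ltW; case: eb => _ _ + _; apply.
Qed.

(* The series is the image under the bounded operator [B] of the expansion of
   [x], so that its convergence does not require the completeness of [V]. *)
Lemma sqrt_seriesE x : D x -> sqrt_series ip N lam phi x = B x.
Proof.
move=> Dx; apply: cvg_lim; first exact: norm_hausdorff.
have [M hM] : exists M : R, forall x, `|B x| <= M * `|x|.
  by case: AB => -[_ _ [M hM]] _ _ _; exists M => z; have := hM z I; rewrite !(nrm_whole ipV).
apply/cvgrPdist_le => eps eps0.
have : M * `|x - diag ip ph (fun=> 1) n x| @[n --> \oo] --> (0 : R).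
  rewrite -[X in _ --> X](mulr0 M); apply: cvgM; first exact: cvg_cst.
  exact: (basis_cvg ipV eb Dx).
move=> /cvgrPdist_le /(_ _ eps0); apply: filterS => n.
rewrite sub0r normrN => /(le_trans (ler_norm _)); apply: le_trans.
rewrite (_ : partial_sum _ _ _ = B (diag ip ph (fun=> 1) n x)); first by rewrite -sqrt_opB.
rewrite sqrt_op_sum /partial_sum big_mkcond big_mkord; apply: eq_bigr => k _.
rewrite sqrt_opZ mul1r sqrt_op_basis scalerA /zero_ext.
by case: ifP => Nk; rewrite ?scaler0// (ipC ipV (phi k)) mulrC.
Qed.

(** The coefficient of [B x] at [phi k] is that of [x] times [Num.sqrt (lam k)]; the two roots
    cancel the weight [1 / lam k], and Parseval's identity remains. *)
Lemma rkhs_dot x y : D x -> D y -> dot K (B x) (B y) = ip x y.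
Proof.
move=> Dx Dy; apply: cvg_lim; first exact: norm_hausdorff.
have y0 : `|y - y| @[n --> \oo] --> (0 : R).
  by rewrite subrr normr0; exact: cvg_cst.
apply: cvg_trans (ip_cvg ipV (basis_cvg ipV eb Dx) y0).
apply: near_eq_cvg; near=> n.
rewrite (ip_diag ipV) /partial_sum [RHS]big_mkcond big_mkord; apply: eq_bigr => k _.
rewrite mul1r !sqrt_op_sym; have := sqrt_op_basis k; rewrite /zero_ext.
case: ifP => Nk; last by rewrite (ip0l ipV) mul0r.
move=> ->; rewrite !(ipZr ipV) (ipC ipV (phi k)) (ipC ipV (phi k) y).
have lk : 0 < lam k by case: eb => _ _ + _; apply.
rewrite mulrACA -expr2 sqr_sqrtr ?ltW// mulrAC mulfV ?gt_eqF// mul1r//.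
Unshelve. all: by end_near. Qed.

(** [B] kills the kernel of [A], so preimages can be taken in [D], where [B] is isometric. *)
Lemma rkhs_carrier z : carrier K z <-> exists2 x, D x & z = B x.
Proof.
split=> [[x _ <-]|[x _ ->]]; last by exists x.
have [x1 [x2 [D1 A2 ->]]] := D_dec x; exists x1 => //.
by rewrite sqrt_opD (sqrt_op_ker ipV AB A2) addr0.
Qed.

Lemma rkhs_nrmB x y : D x -> D y -> nrm K (B x - B y) = `|x - y|.
Proof.
by move=> Dx Dy; rewrite /nrm -sqrt_opB rkhs_dot ?(norm_ip ipV)//; apply: lin_subspaceB.
Qed.

Lemma sqrt_op_inj x y : D x -> D y -> B x = B y -> x = y.
Proof.
move=> Dx Dy Bxy; apply/eqP; rewrite -subr_eq0 -normr_eq0 -rkhs_nrmB// Bxy subrr.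
rewrite -sqrt_op0 /nrm rkhs_dot ?(ip0l ipV) ?sqrtr0//; by case: sD.
Qed.

End ReproducingKernel.

Lemma svd_form (R : realType) (V : normedModType R) (ip : V -> V -> R)
    (ipV : inner_product ip) (D2 D1 : set V) N T rho f g :
  lin_subspace D1 -> lin_subspace D2 ->
  singular_value_decomposition (InnerSpace D2 ip) (InnerSpace D1 ip) N T rho f g ->
  (forall x, D2 x -> D1 (T x)) ->
  form_svd ip D2 D1 (fun x y => ip (T x) y) (idx N)
    (zero_ext N rho) (zero_ext N f) (zero_ext N g).
Proof.
move=> sD1 sD2 [[Df fo] [Dg go] rho0 rhoD hsum] TD.
split.
- exact: (porth_zero_ext ipV).
- exact: (porth_zero_ext ipV).
- by move=> k; rewrite /zero_ext; case: ifP => // /rho0.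
- move=> j k jk; rewrite /zero_ext; case: (boolP (idx N k)) => Nk.
    by rewrite (idx_le jk Nk); exact: rhoD.
  by case: ifP => // /rho0.
- by move=> k /negbTE; rewrite /zero_ext => ->.
- by move=> k; rewrite /zero_ext; case: ifP => [/Df|_]//; case: sD1.
- by move=> k; rewrite /zero_ext; case: ifP => [/Dg|_]//; case: sD2.
move=> x y Dx Dy.
pose u n := partial_sum N (fun k => rho k *: tensor (InnerSpace D2 ip) (g k) (f k) x) n.
have uT : `|T x - u n| @[n --> \oo] --> (0 : R).
  apply: cvg_trans (hsum x Dx); apply: near_eq_cvg; near=> n.
  by rewrite (norm_ip ipV).
have y0 : `|y - y| @[n --> \oo] --> (0 : R).
  by rewrite subrr normr0; exact: cvg_cst.
apply: cvg_trans (ip_cvg ipV uT y0); apply: near_eq_cvg; near=> n.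
rewrite (ip_suml ipV) [LHS]big_mkcond/= big_mkord; apply: eq_bigr => k _.
rewrite /zero_ext /tensor/=; case: ifP => _; last by rewrite !mul0r.
by rewrite !(ipZl ipV) mulrA.
Unshelve. all: by end_near. Qed.

(** * Canonical correlation in an inner product space *)

Section Compression.
Context (R : realType) (V : normedModType R) (ip : V -> V -> R).
Context (ipV : inner_product ip).
Context (S : V -> V) (S_sym : forall x y, ip (S x) y = ip x (S y)).
Context (D D' : set V) (sD : lin_subspace D).
Context (orthD : forall x y, D x -> D' y -> ip x y = 0).
Context (decD : forall x, exists x1 x2, [/\ D x1, D' x2 & x = x1 + x2]).

Local Notation U := (orthproj ip D).

Lemma orthproj_dec x1 x2 : D x1 -> D' x2 -> U (x1 + x2) = x1.
Proof.
move=> Dx1 Dx2; apply: (orthproj_eq ipV sD Dx1) => v Dv.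
by rewrite addrC addKr (ipC ipV) orthD.
Qed.

Lemma orthproj_in x : D (U x).
Proof. by have [x1 [x2 [Dx1 Dx2 ->]]] := decD x; rewrite orthproj_dec. Qed.

Lemma orthproj_ip x v : D v -> ip (U x) v = ip x v.
Proof.
move=> Dv; have [x1 [x2 [Dx1 Dx2 ->]]] := decD x.
by rewrite orthproj_dec// (ipDl ipV) [in RHS](ipC ipV x2) (orthD Dv Dx2) addr0.
Qed.

Lemma orthproj_sym x y : ip (U x) y = ip x (U y).
Proof.
rewrite -(orthproj_ip x (orthproj_in y)) [RHS](ipC ipV) (orthproj_ip y (orthproj_in x)).
exact: (ipC ipV).
Qed.

Lemma orthproj_id x : D x -> U x = x.
Proof.
move=> Dx; apply: (orthproj_eq ipV sD Dx) => v _.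
by rewrite subrr (ip0l ipV).
Qed.

Lemma compression_sym x y : ip ((U \o S \o U) x) y = ip x ((U \o S \o U) y).
Proof. by rewrite /= orthproj_sym S_sym orthproj_sym. Qed.

Lemma compression_dec x :
  exists x1 x2, [/\ D x1, (U \o S \o U) x2 = 0 & x = x1 + x2].
Proof.
have [x1 [x2 [Dx1 Dx2 ->]]] := decD x; exists x1, x2; split=> //=.
have D0 : D 0 by case: sD.
have S0 : S 0 = 0 by apply: (ipext ipV) => z; rewrite S_sym !(ip0l ipV).
by rewrite -[x2]add0r orthproj_dec// S0 orthproj_id.
Qed.

End Compression.

Section CanonicalCorrelation.
Context (R : realType) (V : normedModType R) (ip : V -> V -> R).
Context (ipV : inner_product ip).
Context (S : V -> V) (S_sym : forall x y, ip (S x) y = ip x (S y)).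
Context (H1 H2 : set V) (sH1 : lin_subspace H1) (sH2 : lin_subspace H2).
Context (orthH : forall x y, H1 x -> H2 y -> ip x y = 0).
Context (decH : forall x, exists x1 x2, [/\ H1 x1, H2 x2 & x = x1 + x2]).

Let I1 := InnerSpace H1 ip.
Let I2 := InnerSpace H2 ip.
Let U1 := orthproj ip H1.
Let U2 := orthproj ip H2.
Let S1 := U1 \o S \o U1.
Let S2 := U2 \o S \o U2.
Let S12 := U1 \o S \o U2.

Context (N1 N2 : option nat) (lambda1 lambda2 : nat -> R) (phi1 phi2 : nat -> V).
Context (eb1 : eigenbasis ip H1 S1 N1 lambda1 phi1).
Context (eb2 : eigenbasis ip H2 S2 N2 lambda2 phi2).
Context (tr : R).
Context (tr1 : forall k, idx N1 k -> k.+1%:R * lambda1 k <= tr).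
Context (tr2 : forall k, idx N2 k -> k.+1%:R * lambda2 k <= tr).

Let K1 := rkhs ip S1 N1 lambda1 phi1.
Let K2 := rkhs ip S2 N2 lambda2 phi2.
Let Gamma1 := sqrt_series ip N1 lambda1 phi1.
Let Gamma2 := sqrt_series ip N2 lambda2 phi2.

Context (C : V -> V) (Cb : bounded_operator I2 I1 C).
Context (C_coef : forall j k, idx N1 j -> idx N2 k ->
  ip (C (phi2 k)) (phi1 j)
  = ip (S (phi2 k)) (phi1 j) / Num.sqrt (lambda1 j * lambda2 k)).

Let T := Gamma1 \o C \o 'pinv_(fun=> 0) H2 Gamma2.

Context (Tstar : V -> V) (T_adj : is_adjoint K2 K1 T Tstar).
Context (N : option nat) (rho : nat -> R) (ft gt : nat -> V).
Context (svdT : singular_value_decomposition K2 K1 N T rho ft gt).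

Let Pi1 m x := \sum_(h < m) eigenprojection ip H1 S1 h x.
Let Pi2 m x := \sum_(h < m) eigenprojection ip H2 S2 h x.
Let S1m m := S1 \o Pi1 m.
Let S2m m := S2 \o Pi2 m.
Let Rm m := mp_inverse ip (sqrt_op ip (S1m m)) \o S12
              \o mp_inverse ip (sqrt_op ip (S2m m)).

Context (r : nat -> nat) (rhom : nat -> nat -> R) (f g : nat -> nat -> V).
Context (svdR : forall m, (0 < m)%N ->
  singular_value_decomposition I2 I1 (Some (r m)) (Rm m) (rhom m) (f m) (g m)).
Context (rhom_gt0 : forall m j, (0 < m)%N -> (j < r m)%N -> 0 < rhom m j).
Context (j : nat) (Nj : idx N j) (rhoj : 0 < rho j).
Context (simple : unit_eigenvector_up_to_sign K1 (T \o Tstar) (rho j ^+ 2) (ft j)).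
Context (signs : \forall m \near \oo, (j < r m)%N ->
  0 <= dot K1 (Gamma1 (f m j)) (ft j) /\ 0 <= dot K2 (Gamma2 (g m j)) (gt j)).

Let orthH' x y : H2 x -> H1 y -> ip x y = 0.
Proof. by move=> Hx Hy; rewrite (ipC ipV) orthH. Qed.

Let decH' x : exists x1 x2, [/\ H2 x1, H1 x2 & x = x1 + x2].
Proof.
by have [x1 [x2 [Hx1 Hx2 ->]]] := decH x; exists x2, x1; split=> //; rewrite addrC.
Qed.

Let S1_in x : H1 (S1 x). Proof. exact: (orthproj_in ipV sH1 orthH decH). Qed.
Let S2_in x : H2 (S2 x). Proof. exact: (orthproj_in ipV sH2 orthH' decH'). Qed.
Let S1_sym := compression_sym ipV S_sym sH1 orthH decH.
Let S2_sym := compression_sym ipV S_sym sH2 orthH' decH'.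
Let S1_dec := compression_dec ipV S_sym sH1 orthH decH.
Let S2_dec := compression_dec ipV S_sym sH2 orthH' decH'.

Let ft_norm k : idx N k -> dot K1 (ft k) (ft k) = 1.
Proof. by move=> Nk; case: svdT => -[_ h] _ _ _ _; rewrite h// eqxx. Qed.

Let gt_norm k : idx N k -> dot K2 (gt k) (gt k) = 1.
Proof. by move=> Nk; case: svdT => _ [_ h] _ _ _; rewrite h// eqxx. Qed.

(* The range of the square root contains [ft j], which is not zero. *)
Let sqrt1 : is_sqrt_op ip S1 (sqrt_op ip S1).
Proof.
have [x _ fx] : carrier K1 (ft j) by case: svdT => -[h _] _ _ _ _; exact: h.
apply: (@sqrt_op_exists _ _ _ _ x) => x0.
have : dot K1 (ft j) (ft j) = 0.
  rewrite -fx x0; apply: cvg_lim; first exact: norm_hausdorff.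
  apply: cvg_near_cst; near=> n.
  by rewrite /partial_sum big1// => k _; rewrite (ip0l ipV) !mul0r.
by rewrite ft_norm// => /eqP; rewrite oner_eq0.
Unshelve. all: by end_near. Qed.

Let sqrt2 : is_sqrt_op ip S2 (sqrt_op ip S2).
Proof.
have [x _ fx] : carrier K2 (gt j) by case: svdT => _ [h _] _ _ _; exact: h.
apply: (@sqrt_op_exists _ _ _ _ x) => x0.
have : dot K2 (gt j) (gt j) = 0.
  rewrite -fx x0; apply: cvg_lim; first exact: norm_hausdorff.
  apply: cvg_near_cst; near=> n.
  by rewrite /partial_sum big1// => k _; rewrite (ip0l ipV) !mul0r.
by rewrite gt_norm// => /eqP; rewrite oner_eq0.
Unshelve. all: by end_near. Qed.

Let B1 := sqrt_op ip S1.
Let B2 := sqrt_op ip S2.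

Let Gamma1E x : H1 x -> Gamma1 x = B1 x.
Proof. exact: (sqrt_seriesE ipV S1_sym eb1 sqrt1). Qed.
Let Gamma2E x : H2 x -> Gamma2 x = B2 x.
Proof. exact: (sqrt_seriesE ipV S2_sym eb2 sqrt2). Qed.
Let dot1 x y : H1 x -> H1 y -> dot K1 (B1 x) (B1 y) = ip x y.
Proof. exact: (rkhs_dot ipV S1_sym eb1 sqrt1). Qed.
Let dot2 x y : H2 x -> H2 y -> dot K2 (B2 x) (B2 y) = ip x y.
Proof. exact: (rkhs_dot ipV S2_sym eb2 sqrt2). Qed.
Let car1 z : carrier K1 z <-> exists2 x, H1 x & z = B1 x.
Proof. exact: (rkhs_carrier ipV N1 lambda1 phi1 sqrt1 S1_dec). Qed.
Let car2 z : carrier K2 z <-> exists2 x, H2 x & z = B2 x.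
Proof. exact: (rkhs_carrier ipV N2 lambda2 phi2 sqrt2 S2_dec). Qed.
Let B2_inj := sqrt_op_inj ipV sH2 S2_sym eb2 sqrt2.
Let B1_inj := sqrt_op_inj ipV sH1 S1_sym eb1 sqrt1.

Let C_in x : H2 x -> H1 (C x). Proof. by case: Cb => + _ _; apply. Qed.
Let C_lin (a : R) x y : H2 x -> H2 y -> C (a *: x + y) = a *: C x + C y.
Proof. by case: Cb => _ + _; apply. Qed.

Let C0 : C 0 = 0.
Proof.
have H0 : H2 0 by case: sH2.
have := C_lin 1 H0 H0; rewrite scaler0 scale1r addr0 => /eqP.
by rewrite -{1}[C 0]addr0 (inj_eq (addrI _)) eq_sym => /eqP.
Qed.

(** Injectivity of [Gamma2] on [H2] makes ['pinv_] a genuine left inverse there. Hence the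
    isometries [B1] and [B2] carry [C] to [T], and singular systems can be pulled back. *)
Let TB x : H2 x -> T (B2 x) = B1 (C x).
Proof.
move=> Hx; rewrite /T /= -Gamma2E// pinvKV ?inE//; last first.
  by move=> y z; rewrite !inE => Hy Hz; rewrite !Gamma2E//; exact: B2_inj.
by rewrite Gamma1E//; exact: C_in.
Qed.

Let preimages : exists f0 g0 : nat -> V,
  (forall k, idx N k -> H1 (f0 k) /\ ft k = B1 (f0 k)) /\
  (forall k, idx N k -> H2 (g0 k) /\ gt k = B2 (g0 k)).
Proof.
have hf k : exists x, idx N k -> H1 x /\ ft k = B1 x.
  case: (boolP (idx N k)) => Nk; last by exists 0.
  have /car1[x Hx ->] : carrier K1 (ft k) by case: svdT => -[h _] _ _ _ _; exact: h.
  by exists x.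
have hg k : exists x, idx N k -> H2 x /\ gt k = B2 x.
  case: (boolP (idx N k)) => Nk; last by exists 0.
  have /car2[x Hx ->] : carrier K2 (gt k) by case: svdT => _ [h _] _ _ _; exact: h.
  by exists x.
have [f0 f0P] := choice hf; have [g0 g0P] := choice hg.
by exists f0, g0.
Qed.

Section Preimages.
Context (f0 g0 : nat -> V).
Context (f0P : forall k, idx N k -> H1 (f0 k) /\ ft k = B1 (f0 k)).
Context (g0P : forall k, idx N k -> H2 (g0 k) /\ gt k = B2 (g0 k)).

Let svdC : singular_value_decomposition I2 I1 N C rho f0 g0.
Proof.
case: svdT => -[_ fo] [_ go] rho0 rhoD hsum; split=> //.
- split=> [k /f0P[]//|i k Ni Nk].
  have [[Hi fi] [Hk fk]] := (f0P Ni, f0P Nk).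
  by rewrite /= -dot1// -fi -fk fo.
- split=> [k /g0P[]//|i k Ni Nk].
  have [[Hi fi] [Hk fk]] := (g0P Ni, g0P Nk).
  by rewrite /= -dot2// -fi -fk go.
move=> x Hx; have /hsum h : carrier K2 (B2 x) by apply/car2; exists x.
apply: cvg_trans h; apply: near_eq_cvg; near=> n.
rewrite TB// (_ : partial_sum _ _ _ =
    B1 (partial_sum N (fun k => rho k *: tensor I2 (g0 k) (f0 k) x) n)).
  rewrite (rkhs_nrmB ipV sH1 S1_sym eb1 sqrt1) ?(norm_ip ipV)//; first exact: C_in.
  apply: (@big_rec _ H1); first by case: sH1.
  move=> i y Ni Hy; apply: lin_subspaceD => //; apply: lin_subspaceZ => //.
  by apply: lin_subspaceZ => //; case: (f0P Ni).
rewrite /partial_sum /B1 (sqrt_op_sum ipV sqrt1); apply: eq_bigr => k Nk.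
have [[Hk fk] [Hk' gk]] := (f0P Nk, g0P Nk).
by rewrite /tensor !(sqrt_opZ ipV sqrt1) -/B1 -fk gk dot2.
Unshelve. all: by end_near. Qed.

Let formC := svd_form ipV sH1 sH2 svdC C_in.
Local Notation rho' := (zero_ext N rho).
Local Notation f' := (zero_ext N f0).
Local Notation g' := (zero_ext N g0).

Let eigen_TT i : idx N i -> (T \o Tstar) (ft i) = rho i ^+ 2 *: ft i.
Proof.
move=> Ni; have [Hf fti] := f0P Ni; have [Hg _] := g0P Ni.
have rE : rho' i = rho i by rewrite /zero_ext Ni.
have fE : f' i = f0 i by rewrite /zero_ext Ni.
have gE : g' i = g0 i by rewrite /zero_ext Ni.
have cf : carrier K1 (ft i) by apply/car1; exists (f0 i).
case: T_adj => hT adj.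
have /car2[w Hw Tw] := hT _ cf.
(* [Tstar] is known only through the adjunction, so [w] is identified by testing against [H2]. *)
have wE : w = rho i *: g0 i.
  apply: (ipext_in ipV sH2) => //; first exact: lin_subspaceZ.
  move=> z Hz; rewrite (ipZl ipV) (ipC ipV w) -dot2// -Tw -adj//; last by apply/car2; exists z.
  have := svdEr i formC Hz; rewrite rE fE gE => <-.
  by rewrite TB// fti dot1//; exact: C_in.
rewrite /= Tw wE TB; last exact: lin_subspaceZ.
rewrite fti -(sqrt_opZ ipV sqrt1); congr B1.
apply: (ipext_in ipV sH1); [by apply: C_in; apply: lin_subspaceZ|exact: lin_subspaceZ|].
move=> y Hy.
have -> : C (rho i *: g0 i) = rho i *: C (g0 i).
  by rewrite -[rho i *: g0 i]addr0 C_lin ?C0 ?addr0//; case: sH2.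
rewrite !(ipZl ipV); have := svdEl i formC Hy; rewrite rE fE gE => ->.
by rewrite expr2 mulrA.
Qed.

(** Otherwise [ft i] would be a unit eigenvector for [rho j ^+ 2], hence equal to [ft j] up to sign,
    against orthogonality. *)
Let rho_simple i : idx N i -> i <> j -> rho i <> rho j.
Proof.
move=> Ni ij rij.
have cf : carrier K1 (ft i) by case: svdT => -[h _] _ _ _ _; exact: h.
have nf : nrm K1 (ft i) = 1 by rewrite /nrm ft_norm// sqrtr1.
have /(simple cf nf) : (T \o Tstar) (ft i) = rho j ^+ 2 *: ft i.
  by rewrite eigen_TT// rij.
have [[Hi fi] [Hj fj]] := (f0P Ni, f0P Nj).
have fij : ip (f0 i) (f0 j) = 0.
  by rewrite -dot1// -fi -fj; case: svdT => -[_ ->//] _ _ _ _; case: eqP.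
have fjj : ip (f0 j) (f0 j) = 1 by rewrite -dot1// -fj ft_norm.
have B1N : B1 (- f0 j) = - B1 (f0 j).
  by rewrite -[- f0 j]scaleN1r /B1 (sqrt_opZ ipV sqrt1) scaleN1r.
have HN : H1 (- f0 j) by rewrite -scaleN1r; exact: lin_subspaceZ.
rewrite fi fj => -[|]; rewrite -?B1N => /B1_inj -/(_ Hi) h.
  by move: fij; rewrite h// fjj => /eqP; rewrite oner_eq0.
by move: fij; rewrite h// (ipNl ipV) fjj => /eqP; rewrite oppr_eq0 oner_eq0.
Qed.

Let gap_succ : rho' j.+1 < rho' j.
Proof.
(* If [j.+1] lies outside the index set, the extended sequence is 0 there and the gap is [rhoj]. *)
rewrite /zero_ext Nj; case: ifP => // Nj1.
rewrite lt_neqAle; apply/andP; split.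
  by apply/eqP; apply: rho_simple => //; apply/eqP; rewrite gtn_eqF.
by case: svdT => _ _ _ h _; exact: h.
Qed.

Let gap_pred : (0 < j)%N -> rho' j < rho' j.-1.
Proof.
move=> j0; have Nj1 : idx N j.-1 by apply: idx_le Nj; exact: leq_pred.
rewrite /zero_ext Nj Nj1 lt_neqAle; apply/andP; split.
  apply/eqP => /esym; apply: rho_simple => //; apply/eqP.
  by rewrite ltn_eqF// prednK.
by case: svdT => _ _ _ h _; apply: h => //; exact: leq_pred.
Qed.

Section Truncation.
Context (M1 M2 : nat -> nat).
Context (M1_le : forall m, (m <= M1 m)%N) (M2_le : forall m, (m <= M2 m)%N).
Local Notation P1 := (trunc ip N1 lambda1 phi1 M1).
Local Notation P2 := (trunc ip N2 lambda2 phi2 M2).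
Context (Pi1E : forall m x, Pi1 m x = P1 m x) (Pi2E : forall m x, Pi2 m x = P2 m x).
Local Notation ph1 := (zero_ext N1 phi1).
Local Notation ph2 := (zero_ext N2 phi2).

Let porth1 := porth_eigenbasis ipV eb1.
Let porth2 := porth_eigenbasis ipV eb2.

Let P1_in m x : H1 (P1 m x).
Proof. by apply: (lin_subspace_diag _ _ _ _ sH1); exact: (D_eigenbasis sH1 eb1). Qed.
Let P2_in m x : H2 (P2 m x).
Proof. by apply: (lin_subspace_diag _ _ _ _ sH2); exact: (D_eigenbasis sH2 eb2). Qed.

Let C_sum (I : Type) (s : seq I) (a : I -> R) (u : I -> V) :
  (forall i, H2 (u i)) -> C (\sum_(i <- s) a i *: u i) = \sum_(i <- s) a i *: C (u i).
Proof.
move=> Hu; have H0 : H2 0 by case: sH2.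
(* [C] is linear on [H2] only, so membership is carried through the induction. *)
suff [] : H2 (\sum_(i <- s) a i *: u i) /\
  C (\sum_(i <- s) a i *: u i) = \sum_(i <- s) a i *: C (u i) by [].
elim: s => [|i s [IH IHC]].
  by rewrite !big_nil.
rewrite !big_cons; split; first by case: sH2 => _; apply.
by rewrite C_lin// IHC.
Qed.

(** Linearity of [S] comes from its symmetry. *)
Let S_sum (I : Type) (s : seq I) (a : I -> R) (u : I -> V) :
  S (\sum_(i <- s) a i *: u i) = \sum_(i <- s) a i *: S (u i).
Proof.
apply: (ipext ipV) => z; rewrite S_sym !(ip_suml ipV).
by apply: eq_bigr => i _; rewrite !(ipZl ipV) S_sym.
Qed.

Let mp1 m : mp_inverse ip (sqrt_op ip (S1m m)) =
  diag ip ph1 (fun k => (Num.sqrt (lambda1 k * (level lambda1 k < m)%N%:R))^-1) (M1 m).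
Proof.
have -> : S1m m = diag ip ph1 (fun k => lambda1 k * (level lambda1 k < m)%N%:R) (M1 m).
  by apply/funext => x; rewrite /S1m /= Pi1E; exact: (A_diag ipV S1_sym eb1).
rewrite (sqrt_op_diag ipV _ porth1) ?(mp_inverse_diag ipV _ _ porth1)// => k Nk.
by rewrite mulr_ge0//; apply: ltW; case: eb1 => _ _ + _; apply.
Qed.

Let mp2 m : mp_inverse ip (sqrt_op ip (S2m m)) =
  diag ip ph2 (fun k => (Num.sqrt (lambda2 k * (level lambda2 k < m)%N%:R))^-1) (M2 m).
Proof.
have -> : S2m m = diag ip ph2 (fun k => lambda2 k * (level lambda2 k < m)%N%:R) (M2 m).
  by apply/funext => x; rewrite /S2m /= Pi2E; exact: (A_diag ipV S2_sym eb2).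
rewrite (sqrt_op_diag ipV _ porth2) ?(mp_inverse_diag ipV _ _ porth2)// => k Nk.
by rewrite mulr_ge0//; apply: ltW; case: eb2 => _ _ + _; apply.
Qed.

(** On kept basis vectors the two pseudo-inverses contribute the factor 1 / sqrt(lambda1 lambda2),
    which turns the coefficients of [S] into those of [C]; on the others they contribute 0. *)
Let Rm_form m x y : ip (Rm m x) y = ip (C (P2 m x)) (P1 m y).
Proof.
rewrite /Rm /S12 /U1 /U2 /= mp1 mp2 (diag_sym ipV).
rewrite (orthproj_ip ipV sH1 orthH decH); last first.
  by apply: (lin_subspace_diag _ _ _ _ sH1); exact: (D_eigenbasis sH1 eb1).
rewrite (orthproj_id ipV sH2); last first.
  by apply: (lin_subspace_diag _ _ _ _ sH2); exact: (D_eigenbasis sH2 eb2).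
rewrite S_sum C_sum; last exact: (D_eigenbasis sH2 eb2).
rewrite !(ip_suml ipV); apply: eq_bigr => k _.
rewrite !(ipZl ipV) !(ip_sumr ipV) !mulr_sumr; apply: eq_bigr => i _.
rewrite !(ipZr ipV).
case: (boolP (idx N2 k)) => Nk; last first.
  by rewrite (porth0 ipV porth2 Nk) (ip0l ipV) !(mulr0, mul0r).
case: (boolP (idx N1 i)) => Ni; last first.
  by rewrite (porth0 ipV porth1 Ni) (ip0l ipV) !(mulr0, mul0r).
rewrite /zero_ext Nk Ni C_coef//.
have l1 : 0 < lambda1 i by case: eb1 => _ _ + _; apply.
have l2 : 0 < lambda2 k by case: eb2 => _ _ + _; apply.
case: (_ < _)%N; last by rewrite !(mulr0, sqrtr0, invr0, mul0r).
case: (_ < _)%N; last by rewrite !(mulr0, sqrtr0, invr0, mul0r).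
by rewrite !mulr1 mul1r mul1r sqrtrM ?ltW// invfM; ring.
Qed.

Let P_idem1 m x : P1 m (P1 m x) = P1 m x.
Proof.
rewrite -[LHS]/((P1 m \o P1 m) x) (diag_comp ipV _ _ _ porth1).
by apply: eq_bigr => k _; case: (_ < _)%N; rewrite ?mulr0 ?mulr1.
Qed.

Let P_idem2 m x : P2 m (P2 m x) = P2 m x.
Proof.
rewrite -[LHS]/((P2 m \o P2 m) x) (diag_comp ipV _ _ _ porth2).
by apply: eq_bigr => k _; case: (_ < _)%N; rewrite ?mulr0 ?mulr1.
Qed.

Let am m x y := ip (Rm m x) y.
Let fm m := zero_ext (Some (r m)) (f m).
Let gm m := zero_ext (Some (r m)) (g m).

Let formR m : (0 < m)%N ->
  form_svd ip H2 H1 (am m) (idx (Some (r m))) (zero_ext (Some (r m)) (rhom m)) (fm m) (gm m).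
Proof.
move=> m0; apply: (svd_form ipV sH1 sH2 (svdR m0)) => x Hx.
rewrite /Rm /= mp1; apply: (lin_subspace_diag _ _ _ _ sH1).
exact: (D_eigenbasis sH1 eb1).
Qed.

Let am_eq m : (0 < m)%N -> forall i, am m (gm m i) (fm m i) = ip (C (gm m i)) (fm m i).
Proof.
move=> m0 i; have F := formR m0.
case: (boolP (idx (Some (r m)) i)) => ri; last first.
  by rewrite (porth0 ipV (svd_f F) ri) /am !(ip0r ipV).
have Hf := svd_D1 F i; have Hg := svd_D2 F i.
(* The form of R(m) absorbs [P1] and [P2]; dividing by the nonzero singular value shows that they
   fix its singular vectors. *)
have r0 : zero_ext (Some (r m)) (rhom m) i != 0.
  by rewrite /zero_ext ri gt_eqF//; exact: rhom_gt0.
have fP : P1 m (fm m i) = fm m i.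
  apply: (ipext_in ipV sH1) => [||z Hz]; [exact: P1_in|exact: Hf|apply: (mulfI r0)].
  rewrite (diag_sym ipV) -!(svdEl i F)//; last exact: P1_in.
  by rewrite /am !Rm_form P_idem1.
have gP : P2 m (gm m i) = gm m i.
  apply: (ipext_in ipV sH2) => [||z Hz]; [exact: P2_in|exact: Hg|apply: (mulfI r0)].
  rewrite (diag_sym ipV) -!(svdEr i F)//; last exact: P2_in.
  by rewrite /am !Rm_form P_idem2.
by rewrite /am Rm_form fP gP.
Qed.

Let am_cvg x y : H2 x -> H1 y -> am m x y @[m --> \oo] --> ip (C x) y.
Proof.
move=> Hx Hy.
have [M hM] : exists M : R, forall x, H2 x -> `|C x| <= M * `|x|.
  by case: Cb => _ _ [M hM]; exists M => z /hM; rewrite !(norm_ip ipV).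
rewrite (_ : (fun m => _) = fun m => ip (C (P2 m x)) (P1 m y)); last first.
  by apply/funext => m; rewrite /am Rm_form.
apply: (ip_cvg ipV); last exact: (trunc_cvg ipV eb1).
have Mx : M * `|x - P2 m x| @[m --> \oo] --> (0 : R).
  rewrite -[X in _ --> X](mulr0 M); apply: cvgM; first exact: cvg_cst.
  exact: (trunc_cvg ipV eb2).
apply: (squeeze_cvgr _ (cvg_cst 0) Mx); near=> m; rewrite normr_ge0/=.
have -> : C x - C (P2 m x) = C (x - P2 m x).
  by have := C_lin (-1) (P2_in m x) Hx; rewrite !scaleN1r addrC => ->; rewrite addrC.
by apply: hM; exact: lin_subspaceB.
Unshelve. all: by end_near. Qed.

Lemma weight_functions_cvg_aux :
  (fun m => nrm K1 (Gamma1 (f m j) - ft j)) @ \oo --> (0 : R) /\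
  (fun m => nrm K2 (Gamma2 (g m j) - gt j)) @ \oo --> (0 : R).
Proof.
have [Hf fj] := f0P Nj; have [Hg gj] := g0P Nj.
have near_svd : \forall m \near \oo, form_svd ip H2 H1 (am m) (idx (Some (r m)))
    (zero_ext (Some (r m)) (rhom m)) (fm m) (gm m).
  by near=> m; apply: formR; near: m; exact: nbhs_infty_gt.
have near_eq : \forall m \near \oo, forall i,
    am m (gm m i) (fm m i) = ip (C (gm m i)) (fm m i).
  by near=> m; apply: am_eq; near: m; exact: nbhs_infty_gt.
have near_sgn : \forall m \near \oo, idx (Some (r m)) j ->
    0 <= ip (fm m j) (f' j) /\ 0 <= ip (gm m j) (g' j).
  near=> m => rj.
  have F : form_svd ip H2 H1 (am m) (idx (Some (r m)))
    (zero_ext (Some (r m)) (rhom m)) (fm m) (gm m) by near: m.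
  have : (j < r m)%N -> 0 <= dot K1 (Gamma1 (f m j)) (ft j) /\
      0 <= dot K2 (Gamma2 (g m j)) (gt j) by near: m.
  move=> /(_ rj); have := svd_D1 F j; have := svd_D2 F j.
  rewrite /fm /gm /zero_ext Nj rj => Hgm Hfm.
  by rewrite fj gj Gamma1E// Gamma2E// dot1// dot2.
(* [near_r] says that eventually [j < r m], where the zero extensions agree with [f m j] and
   [g m j]. *)
have [near_r cf cg] := singular_vectors_cvg ipV formC near_svd am_cvg near_eq
  Nj gap_succ gap_pred near_sgn.
split.
  apply: cvg_trans cf; apply: near_eq_cvg; near=> m.
  have rj : idx (Some (r m)) j by near: m.
  have F : form_svd ip H2 H1 (am m) (idx (Some (r m)))
    (zero_ext (Some (r m)) (rhom m)) (fm m) (gm m) by near: m.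
  have := svd_D1 F j; rewrite /fm /zero_ext Nj rj => Hfm.
  by rewrite fj Gamma1E// (rkhs_nrmB ipV sH1 S1_sym eb1 sqrt1).
apply: cvg_trans cg; apply: near_eq_cvg; near=> m.
have rj : idx (Some (r m)) j by near: m.
have F : form_svd ip H2 H1 (am m) (idx (Some (r m)))
  (zero_ext (Some (r m)) (rhom m)) (fm m) (gm m) by near: m.
have := svd_D2 F j; rewrite /gm /zero_ext Nj rj => Hgm.
by rewrite gj Gamma2E// (rkhs_nrmB ipV sH2 S2_sym eb2 sqrt2).
Unshelve. all: by end_near. Qed.

End Truncation.
End Preimages.

Lemma weight_functions_cvg :
  (fun m => nrm K1 (Gamma1 (f m j) - ft j)) @ \oo --> (0 : R) /\
  (fun m => nrm K2 (Gamma2 (g m j) - gt j)) @ \oo --> (0 : R).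
Proof.
have [f0 [g0 [f0P g0P]]] := preimages.
have [M1 M1_le Pi1E] := eigenprojection_sum ipV sH1 S1_in S1_sym eb1 tr1.
have [M2 M2_le Pi2E] := eigenprojection_sum ipV sH2 S2_in S2_sym eb2 tr2.
exact: (weight_functions_cvg_aux f0P g0P M1_le M2_le Pi1E Pi2E).
Qed.

End CanonicalCorrelation.

(** * The covariance operator on L^2 *)

Section L2Dot.
Context d (T : measurableType d) (R : realType) (mu : {measure set T -> \bar R}).
Implicit Types x y z : L2 mu.

Lemma L2_mul_integrable x y : mu.-integrable setT (EFin \o (fun t => x t * y t)).
Proof.
have xL : (x : T -> R) \in Lfun mu 2%:R%:E := LfunP (Lfun_of_L2 x).
have yL : (y : T -> R) \in Lfun mu 2%:R%:E := LfunP (Lfun_of_L2 y).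
by apply/Lfun1_integrable; exact: Lfun2_mul_Lfun1.
Qed.

Lemma L2_dot_inner_product : inner_product (@L2_dot _ _ _ mu).
Proof.
split=> [x y|a x y z|x]; last by rewrite L2_normE.
  by rewrite /L2_dot; apply: eq_Rintegral => t _; rewrite mulrC.
have xz := L2_mul_integrable x z; have yz := L2_mul_integrable y z.
have axz : mu.-integrable setT (EFin \o (fun t => a * (x t * z t))).
  exact: (integrableZl _ a xz).
rewrite /L2_dot -RintegralZl// -RintegralD// /Rintegral; congr fine.
apply: ae_eq_integral => //.
- exact: (measurable_int _ (L2_mul_integrable _ _)).
- exact: (measurable_int _ (integrableD _ axz yz)).
(* The operations of [L2] agree with the pointwise ones only almost everywhere. *)
have := L2_addE (a *: x) y; have : (a *: x : L2 mu) = (fun t => a * x t) %[ae mu].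
  exact: L2_of_LfunE.
apply: filterS2 => t /(_ I) /= h1 /(_ I) /= h2 _.
rewrite (_ : L2_fun (a *: x + y) t = a * x t + y t) ?mulrDl ?mulrA//.
by rewrite -h1; exact: h2.
Qed.

End L2Dot.

Section Covariance.
Context (R : realType) (d' : measure_display) (T : measurableType d').
Context (mu : {measure set T -> \bar R}).
Context (d : measure_display) (Omega : measurableType d) (P : probability Omega R).
Context (X : Omega -> L2 mu) (S : L2 mu -> L2 mu).
Context (covS : is_covariance_operator P X S).

Local Notation ip := (@L2_dot _ _ _ mu).
Let ipV : inner_product ip := L2_dot_inner_product mu.

Lemma covariance_integrable h k :
  P.-integrable setT (EFin \o (fun w => ip (X w) h * ip (X w) k)).
Proof.
have [int _] := covS h k; apply: eq_integrable int => // w _ /=.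
by rewrite /tensor/= (ipZl ipV).
Qed.

Lemma covarianceE h k : ip (S h) k = \int[P]_w (ip (X w) h * ip (X w) k).
Proof.
have [_ <-] := covS h k; apply: eq_Rintegral => w _.
by rewrite /tensor/= (ipZl ipV).
Qed.

Lemma covariance_sym h k : ip (S h) k = ip h (S k).
Proof.
rewrite (ipC ipV h) !covarianceE; apply: eq_Rintegral => w _.
by rewrite mulrC.
Qed.

Context (rX : random_element X).
Context (X4 : (\int[P]_w (`|X w| ^+ 4)%:E < +oo)%E).

Lemma measurable_norm_random_element : measurable_fun setT (fun w => `|X w|).
Proof.
apply: (measurability _ (RGenOInfty.measurableE R)) => //.
move=> _ [_ [a ->] <-]; rewrite setTI.
rewrite (_ : _ @^-1` _ = X @^-1` ((fun x : L2 mu => `|x|) @^-1` `]a, +oo[))//.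
apply: rX; apply: open_comp => //.
by move=> x _; exact: norm_continuous.
Qed.

Lemma sqr_norm_integrable : P.-integrable setT (EFin \o (fun w => `|X w| ^+ 2)).
Proof.
have mX := measurable_norm_random_element.
have int4 : P.-integrable setT (EFin \o (fun w => `|X w| ^+ 4)).
  apply/integrableP; split; first by apply/measurable_EFinP; exact: measurable_funX.
  under eq_integral do rewrite /= ger0_norm ?exprn_ge0//.
  exact: X4.
(* The square is dominated through t^2 <= 1 + t^4, the constant being integrable for a
   probability. *)
have int1 := finite_measure_integrable_cst P 1 measurableT.
apply: le_integrable (integrableD measurableT int1 int4) => //.
  by apply/measurable_EFinP; exact: measurable_funX.
move=> w _ /=; rewrite lee_fin.
rewrite !ger0_norm ?addr_ge0 ?exprn_ge0//.
have := sqr_ge0 (`|X w| ^+ 2 - 1); have := sqr_ge0 (`|X w|); nra.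
Qed.

(** The left side is the expectation of the sum of the squared coefficients of [X w], which Bessel
    bounds pointwise. *)
Lemma covariance_trace_le (Q : pred nat) e n : porth ip Q e ->
  \sum_(i < n) ip (S (e i)) (e i) <= \int[P]_w (`|X w| ^+ 2).
Proof.
move=> eQ; pose F n w := \sum_(i < n) ip (X w) (e i) * ip (X w) (e i).
have FE m : P.-integrable setT (EFin \o F m) /\
    \sum_(i < m) ip (S (e i)) (e i) = \int[P]_w F m w.
  elim: m => [|m [IHi IHm]].
    rewrite (_ : F 0%N = cst 0); last by apply/funext => w; rewrite /F big_ord0.
    by split; [exact: finite_measure_integrable_cst|rewrite big_ord0 Rintegral_cst// mul0r].
  have -> : F m.+1 = fun w => F m w + ip (X w) (e m) * ip (X w) (e m).
    by apply/funext => w; rewrite /F big_ord_recr.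
  split; first exact: (integrableD _ IHi (covariance_integrable _ _)).
  by rewrite RintegralD//; [rewrite big_ord_recr/= IHm covarianceE|exact: covariance_integrable].
have [Fi ->] := FE n; apply: le_Rintegral => //; first exact: sqr_norm_integrable.
move=> w _; rewrite -(ip_norm ipV); apply: le_trans (bessel ipV n (X w) eQ).
by apply: ler_sum => i _; rewrite expr2 (ipC ipV (X w)).
Qed.

(** Indices start at 0: the [k.+1] eigenvalues up to [lam k] each dominate it, and their sum is a
    partial trace of [S]. *)
Lemma eigenvalue_trace_le (D D' : set (L2 mu)) N lam phi : lin_subspace D ->
  (forall x y, D x -> D' y -> ip x y = 0) ->
  (forall x, exists x1 x2, [/\ D x1, D' x2 & x = x1 + x2]) ->
  eigenbasis ip D (orthproj ip D \o S \o orthproj ip D) N lam phi ->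
  forall k, idx N k -> k.+1%:R * lam k <= \int[P]_w (`|X w| ^+ 2).
Proof.
move=> sD oD dD eb k Nk; have pP := porth_eigenbasis ipV eb.
apply: le_trans (covariance_trace_le k.+1 pP).
have [_ _ _ lamD] := eb.
rewrite mulr_natl -[X in _ *+ X]card_ord -sumr_const; apply: ler_sum => i _.
have ik : (i <= k)%N by rewrite -ltnS.
have Ni := idx_le ik Nk; apply: (le_trans (lamD _ _ ik Nk)).
have Dp := D_eigenbasis sD eb i.
rewrite -{1}(orthproj_id ipV sD Dp) -(orthproj_ip ipV sD oD dD _ Dp).
have := A_eigenbasis ipV (compression_sym ipV covariance_sym sD oD dD) eb i.
by move=> /= ->; rewrite (ipZl ipV) pP eqxx Ni mulr1.
Qed.

End Covariance.

Theorem theorem7p2 (R : realType) (E : set R)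
    (nu : {sigma_finite_measure set (measurableTypeR R) -> \bar R})
    (d : measure_display) (Omega : measurableType d) (P : probability Omega R)
    (X : Omega -> L2 nu) (S : L2 nu -> L2 nu) (H1 H2 : set (L2 nu)) :
  carried_by nu E ->
  (* X is a mean-zero random element of L^2(E, nu) with covariance S *)
  random_element X ->
  is_expectation P X 0 ->
  (\int[P]_w (`|X w| ^+ 4)%:E < +oo)%E ->
  is_covariance_operator P X S ->
  (* orthogonal decomposition of L^2(E, nu) *)
  closed_subspace H1 -> closed_subspace H2 ->
  (forall x y, H1 x -> H2 y -> L2_dot x y = 0) ->
  (forall x, exists x1 x2, [/\ H1 x1, H2 x2 & x = x1 + x2]) ->
  let ip := @L2_dot _ _ _ nu in
  let I1 := InnerSpace H1 ip in
  let I2 := InnerSpace H2 ip in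
  let U1 := orthproj ip H1 in
  let U2 := orthproj ip H2 in
  let S1 := U1 \o S \o U1 in
  let S2 := U2 \o S \o U2 in
  let S12 := U1 \o S \o U2 in
  (forall x, H1 x -> S1 x = 0 -> x = 0) ->
  (forall x, H2 x -> S2 x = 0 -> x = 0) ->
  forall (N1 N2 : option nat) (lambda1 lambda2 : nat -> R)
    (phi1 phi2 : nat -> L2 nu),
  eigenbasis ip H1 S1 N1 lambda1 phi1 ->
  eigenbasis ip H2 S2 N2 lambda2 phi2 ->
  let gamma j k :=
    \int[P]_w (ip (U1 (X w)) (phi1 j) * ip (U2 (X w)) (phi2 k)) in
  let K1 := rkhs ip S1 N1 lambda1 phi1 in
  let K2 := rkhs ip S2 N2 lambda2 phi2 in
  let Gamma1 := sqrt_series ip N1 lambda1 phi1 in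
  let Gamma2 := sqrt_series ip N2 lambda2 phi2 in
  (* T = Gamma1 C Gamma2^-1 *)
  forall C : L2 nu -> L2 nu,
  bounded_operator I2 I1 C ->
  (forall j k, idx N1 j -> idx N2 k ->
    ip (C (phi2 k)) (phi1 j) = gamma j k / Num.sqrt (lambda1 j * lambda2 k)) ->
  let T := Gamma1 \o C \o 'pinv_(fun=> 0) H2 Gamma2 in
  forall Tstar : L2 nu -> L2 nu,
  is_adjoint K2 K1 T Tstar ->
  forall (N : option nat) (rho : nat -> R) (ft gt : nat -> L2 nu),
  singular_value_decomposition K2 K1 N T rho ft gt ->
  (* the truncated operators R(m) and their singular value decompositions,
     of length r m = rank (R(m)^* R(m)) since the rhom m j are positive *)
  let Pi1 m x := \sum_(h < m) eigenprojection ip H1 S1 h x in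
  let Pi2 m x := \sum_(h < m) eigenprojection ip H2 S2 h x in
  let S1m m := S1 \o Pi1 m in
  let S2m m := S2 \o Pi2 m in
  let Rm m := mp_inverse ip (sqrt_op ip (S1m m)) \o S12
                \o mp_inverse ip (sqrt_op ip (S2m m)) in
  forall (r : nat -> nat) (rhom : nat -> nat -> R) (f g : nat -> nat -> L2 nu),
  (forall m, (0 < m)%N ->
    singular_value_decomposition I2 I1 (Some (r m)) (Rm m)
      (rhom m) (f m) (g m)) ->
  (forall m j, (0 < m)%N -> (j < r m)%N -> 0 < rhom m j) ->
  forall j : nat, idx N j -> 0 < rho j ->
  (* eigenvectors are determined up to sign, and the sign convention *)
  unit_eigenvector_up_to_sign K1 (T \o Tstar) (rho j ^+ 2) (ft j) ->
  unit_eigenvector_up_to_sign K2 (Tstar \o T) (rho j ^+ 2) (gt j) ->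
  (\forall m \near \oo, (j < r m)%N ->
    0 <= dot K1 (Gamma1 (f m j)) (ft j) /\
    0 <= dot K2 (Gamma2 (g m j)) (gt j)) ->
  (fun m => nrm K1 (Gamma1 (f m j) - ft j)) @ \oo --> (0 : R) /\
  (fun m => nrm K2 (Gamma2 (g m j) - gt j)) @ \oo --> (0 : R).
Proof.
move=> _ rX _ X4 covS [_ H10 H1lin] [_ H20 H2lin] orthH decH ip I1 I2 U1 U2 S1 S2 S12 _ _.
move=> N1 N2 lambda1 lambda2 phi1 phi2 eb1 eb2 gamma K1 K2 Gamma1 Gamma2.
move=> C Cb C_coef T Tstar T_adj N rho ft gt svdT Pi1 Pi2 S1m S2m Rm.
move=> r rhom f g svdR rhom_gt0 j Nj rhoj simple _ signs.
have ipV : inner_product ip := L2_dot_inner_product nu.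
have sH1 : lin_subspace H1 by [].
have sH2 : lin_subspace H2 by [].
have orthH' x y : H2 x -> H1 y -> ip x y = 0.
  by move=> Hx Hy; rewrite (ipC ipV); exact: orthH.
have decH' x : exists x1 x2, [/\ H2 x1, H1 x2 & x = x1 + x2].
  by have [x1 [x2 [Hx1 Hx2 ->]]] := decH x; exists x2, x1; split=> //; rewrite addrC.
have tr1 := eigenvalue_trace_le covS rX X4 sH1 orthH decH eb1.
have tr2 := eigenvalue_trace_le covS rX X4 sH2 orthH' decH' eb2.
have coef i k : idx N1 i -> idx N2 k ->
    ip (C (phi2 k)) (phi1 i) = ip (S (phi2 k)) (phi1 i) / Num.sqrt (lambda1 i * lambda2 k).
  move=> Ni Nk; rewrite C_coef//; congr (_ / _).
  rewrite /ip (covarianceE covS); apply: eq_Rintegral => w _.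
  have Hi : H1 (phi1 i) by case: eb1 => -[[h _] _] _ _ _; exact: h.
  have Hk : H2 (phi2 k) by case: eb2 => -[[h _] _] _ _ _; exact: h.
  by rewrite (orthproj_ip ipV sH1 orthH decH _ Hi) (orthproj_ip ipV sH2 orthH' decH' _ Hk) mulrC.
exact: (weight_functions_cvg ipV (covariance_sym covS) sH1 sH2 orthH decH eb1 eb2
  tr1 tr2 Cb coef T_adj svdT svdR rhom_gt0 Nj rhoj simple signs).
Qed.
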